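(* Let $K\ge1$, let $\alpha_1,\dots,\alpha_K>0$ with $\sum_j\alpha_j=1$, and let $n\ge1$ be an integer. The following holds for generic $\theta_*\in\mathbb R^K$. Define $f_{n+1}:\mathbb R^K\to\mathbb R$ by $f_{n+1}(\theta)=\frac12(p_{n+1}(\theta)-p_{n+1}^* )^2$, where $p_{n+1}^*=p_{n+1}(\theta_* )$. Then: (a) A point $x=(x_1,\dots,x_K)\in\mathcal V_n\setminus\mathcal V_{n+1}$ is a critical point of $f_{n+1}|_{\mathcal V_n}$ if and only if it is a critical point of $p_{n+1}|_{\mathcal V_n}$, if and only if the coordinates $x_1,\dots,x_K$ take exactly $n$ distinct values. (b) Let $x\in\mathcal V_n\setminus\mathcal V_{n+1}$ be a critical point of $f_{n+1}|_{\mathcal V_n}$. Let $y_1>y_2>\dots>y_n$ be the distinct values of the coordinates of $x$, and let $(m_1,\dots,m_n)$ be the multiplicity vector, i.e. $m_i$ is the number of coordinates of $x$ equal to $y_i$. Then: - If the multiplicity vector has the form $(m_1,1,m_3,1,\dots)$ (that is, $m_i=1$ for all even $i$), then $x$ is a local minimum of $f_{n+1}|_{\mathcal V_n}$ if $p_{n+1}(x)>p_{n+1}^*$ and a local maximum if $p_{n+1}(x)<p_{n+1}^*$. - If the multiplicity vector has the form $(1,m_2,1,m_4,\dots)$ (that is, $m_i=1$ for all odd $i$), then $x$ is a local minimum of $f_{n+1}|_{\mathcal V_n}$ if $p_{n+1}(x)<p_{n+1}^*$ and a local maximum if $p_{n+1}(x)>p_{n+1}^*$. - If the multiplicity vector is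 of neither form, then $x$ is a saddle point of $f_{n+1}|_{\mathcal V_n}$ and of $p_{n+1}|_{\mathcal V_n}$. (c) There are no local minima of $f_{n+1}|_{\mathcal V_n}$ on $\mathcal V_n\setminus\mathcal V_{n+1}$ if the weights are uniform ($\alpha_j=1/K$ for all $j$).
   Context: For $\ell\ge1$ and $\theta=(\theta_1,\dots,\theta_K)\in\mathbb R^K$, $p_\ell(\theta)=\sum_{j=1}^K\alpha_j\theta_j^\ell$. For fixed $\theta_*\in\mathbb R^K$, $\mathcal V_k=\{\theta\in\mathbb R^K : p_j(\theta)=p_j(\theta_* ),\ j=1,\dots,k\}$. ''Generic $\theta_*$'' means all $\theta_*\in\mathbb R^K$ outside some Lebesgue-null set (which may depend on $K$, $n$ and the weights). A point $x\in\mathcal V_n$ is a critical point of $h|_{\mathcal V_n}$ (for smooth $h:\mathbb R^K\to\mathbb R$) if $\nabla h(x)$ lies in the span of $\nabla p_1(x),\dots,\nabla p_n(x)$. Local minima and maxima of $h|_{\mathcal V_n}$ are with respect to the subspace topology on $\mathcal V_n$, and a saddle point is a critical point that is neither a local minimum nor a local maximum. *)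

(* Defs.v *)
From HB Require Import structures.
From mathcomp Require Import all_boot all_order all_algebra.
From mathcomp Require Import all_classical all_reals all_analysis.

Set Implicit Arguments.
Unset Strict Implicit.
Unset Printing Implicit Defensive.

Import Order.TTheory GRing.Theory Num.Theory.
Import numFieldNormedType.Exports.

Local Open Scope classical_set_scope.
Local Open Scope ring_scope.

(* The library has no Lebesgue measure on R^K.  Null sets are defined by the
   vanishing of the Lebesgue outer measure: for every e > 0 there is a cover by
   countably many closed boxes [a_k, b_k] of total volume at most e.  The
   condition a_k <= b_k keeps the volumes nonnegative. *)
Definition lebesgue_null (R : realType) (K : nat) (N : set 'rV[R]_K) : Prop :=
  forall e : R, 0 < e -> exists a b : nat -> 'rV[R]_K,
    [/\ forall k j, a k 0 j <= b k 0 j,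
        N `<=` \bigcup_k [set x | forall j, a k 0 j <= x 0 j <= b k 0 j]
      & (\sum_(0 <= k <oo) (\prod_(j < K) (b k 0 j - a k 0 j))%:E <= e%:E)%E].

Definition generic (R : realType) (K : nat) (P : 'rV[R]_K -> Prop) : Prop :=
  exists2 N : set 'rV[R]_K, lebesgue_null N & forall theta, ~ N theta -> P theta.

Definition psum (R : realType) (K : nat) (alpha : 'I_K -> R) (l : nat)
    (theta : 'rV[R]_K) : R :=
  \sum_(j < K) alpha j * theta 0 j ^+ l.

Definition psum_variety (R : realType) (K : nat) (alpha : 'I_K -> R)
    (theta_star : 'rV[R]_K) (k : nat) : set 'rV[R]_K :=
  [set theta | forall j : nat, (1 <= j <= k)%N ->
     psum alpha j theta = psum alpha j theta_star].

Definition psum_loss (R : realType) (K : nat) (alpha : 'I_K -> R)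
    (theta_star : 'rV[R]_K) (l : nat) (theta : 'rV[R]_K) : R :=
  2^-1 * (psum alpha l theta - psum alpha l theta_star) ^+ 2.

Definition grad (R : realType) (K : nat) (h : 'rV[R]_K -> R) (x : 'rV[R]_K) :
    'rV[R]_K :=
  \row_(j < K) 'D_(delta_mx 0 j) h x.

Definition critical_point (R : realType) (K : nat) (alpha : 'I_K -> R)
    (theta_star : 'rV[R]_K) (n : nat) (h : 'rV[R]_K -> R) (x : 'rV[R]_K) : Prop :=
  psum_variety alpha theta_star n x /\
  grad h x \in <<[seq grad (psum alpha l) x | l <- iota 1 n]>>%VS.

Definition local_min_on (R : realType) (T : topologicalType) (A : set T)
    (h : T -> R) (x : T) : Prop :=
  A x /\ \forall y \near within A (nbhs x), h x <= h y.

Definition local_max_on (R : realType) (T : topologicalType) (A : set T)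
    (h : T -> R) (x : T) : Prop :=
  A x /\ \forall y \near within A (nbhs x), h y <= h x.

Definition saddle_point (R : realType) (K : nat) (alpha : 'I_K -> R)
    (theta_star : 'rV[R]_K) (n : nat) (h : 'rV[R]_K -> R) (x : 'rV[R]_K) : Prop :=
  [/\ critical_point alpha theta_star n h x,
      ~ local_min_on (psum_variety alpha theta_star n) h x
    & ~ local_max_on (psum_variety alpha theta_star n) h x].

(* The distinct values y_1 > y_2 > ... of the coordinates of x. *)
Definition coord_values (R : realType) (K : nat) (x : 'rV[R]_K) : seq R :=
  sort >=%R (undup (codom (x 0))).

Definition multiplicities (R : realType) (K : nat) (x : 'rV[R]_K) : seq nat :=
  [seq count_mem y (codom (x 0)) | y <- coord_values x].

(* The entry m_i of the text, with i >= 1, is the item i.-1 of the sequence m. *)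
Definition even_entries_one (m : seq nat) : Prop :=
  forall i : nat, (1 <= i <= size m)%N -> ~~ odd i -> nth 0%N m i.-1 = 1%N.

Definition odd_entries_one (m : seq nat) : Prop :=
  forall i : nat, (1 <= i <= size m)%N -> odd i -> nth 0%N m i.-1 = 1%N.

(* Main.v *)
(** For weights alpha > 0, a point x agreeing with theta_star in its first n power
sums is constrained, through polynomials P of degree at most n, by
sum_j alpha_j P(x_j) = sum_j alpha_j P(theta_star_j).  Everything comes from a
good choice of P, usually through its derivative.

Genericity.  Suppose that x has m distinct coordinates, that p_1, ..., p_(m+1)
agree at x and theta, and that some theta_j0 is not a coordinate of x.  Taking for
P' the Lagrange basis of the m + 1 nodes (values of x, and theta_j0), the
constraints show that theta_j0 is locally a Lipschitz function of the other
coordinates of theta; so such theta lie in countably many Lipschitz graphs, a null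
set.  If all theta_j are coordinates of x, interpolation gives p_l(x) = p_l(theta)
for all l.  Hence, generically, a point of V_n \ V_(n+1) has at least n distinct
coordinates, and it is critical exactly when it has n of them y_1 > ... > y_n.

Local type.  With P' = q = prod_i (t - y_i), on V_n the variation of p_(n+1) is
(n+1) sum_j alpha_j (P(theta_j) - P(x_j)), of second order part
sum_j alpha_j q'(x_j) (theta_j - x_j)^2 / 2, where q'(y_i) has sign (-1)^(i-1).
Coordinates of multiplicity one move only to second order along V_n, so that only
the multiple values matter.  Conversely two coordinates with the same value can be
moved against each other inside V_n (a contraction argument), realizing the sign of
q' at that value.

Uniform weights.  If x has simple values at all even (or all odd) positions, pair
the sorted coordinates X_j of x and T_j of theta_star.  Let P' have as roots the
y_i at the other positions, and at a simple position the partner T_j of y_i clamped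
between y_(i+1) and y_(i-1).  Then all P(T_j) - P(X_j) have the same sign, so x is
a global extremum of p_(n+1) on V_n; this contradicts the sign that a local minimum
of the loss requires. *)
Require Import Defs.
From HB Require Import structures.
From mathcomp Require Import all_boot all_order all_algebra.
From mathcomp Require Import polyrcf ring lra.
From mathcomp Require Import all_classical all_reals all_analysis.

Set Implicit Arguments.
Unset Strict Implicit.
Unset Printing Implicit Defensive.

Import Order.TTheory GRing.Theory Num.Theory.
Import numFieldNormedType.Exports.

Local Open Scope classical_set_scope.
Local Open Scope ring_scope.

(** * Antiderivatives of polynomials *)

Lemma poly_primitive (R : numFieldType) (q : {poly R}) :
  exists2 p : {poly R}, p^`() = q & (size p <= (size q).+1)%N.
Proof.
exists (\poly_(i < (size q).+1) (q`_i.-1 / i%:R)); last exact: size_poly.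
apply/polyP=> i; rewrite coef_deriv coef_poly ltnS /=.
case: ltnP => [_|qi]; first by rewrite -[LHS]mulr_natr divfK ?pnatr_eq0.
by rewrite mul0rn nth_default.
Qed.

(** Integrates the Lagrange basis of the nodes [w]. The degree is at most [n], so only the
    constrained power sums p_1, ..., p_n see [p i]. *)
Lemma lagrange_primitive (R : numFieldType) (n : nat) (w : 'I_n -> R) :
  injective w -> exists2 p : 'I_n -> {poly R},
    forall i, (size (p i) <= n.+1)%N &
    forall i k, (p i)^`().[w k] = (i == k)%:R.
Proof.
move=> w_inj.
pose l i := \prod_(k < n | k != i) ((w i - w k)^-1 *: ('X - (w k)%:P)).
have [p pP] : {p : 'I_n -> {poly R} & forall i, (p i)^`() = l i /\ (size (p i) <= n.+1)%N}.
  apply: (@boolp.choice _ _ (fun i p => p^`() = l i /\ (size p <= n.+1)%N)) => i.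
  have [p pl ps] := poly_primitive (l i); exists p; split=> //.
  apply: leq_trans ps _; rewrite ltnS.
  have -> : l i = (\prod_(k < n | k != i) (w i - w k)^-1) *:
                   \prod_(k < n | k != i) ('X - (w k)%:P).
    by rewrite /l scaler_prod.
  apply: leq_trans (size_scale_leq _ _) _.
  rewrite -big_filter size_prod_XsubC size_filter.
  rewrite -sum1_count sum1_card (cardC1 i) card_ord.
  by case: n i {w w_inj l p pl} => [[]|].
exists p => [i|i k]; first by have [] := pP i.
have [-> _] := pP i; rewrite horner_prod.
have [<-|ik] := eqVneq i k.
  apply: big1 => j ki; rewrite hornerZ !hornerE mulVf // subr_eq0.
  by apply: contra ki => /eqP/w_inj ->.
by rewrite (bigD1 k) 1?eq_sym //= hornerZ !hornerE subrr mulr0 mul0r.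
Qed.

(** Mean value theorem with no order on [u] and [v], the intermediate point being located by its
    distance to a third point [w]: this yields estimates uniform near [w]. *)
Lemma poly_mvt_eq (R : rcfType) (p : {poly R}) (u v w e : R) :
  `|u - w| <= e -> `|v - w| <= e ->
  exists2 c, `|c - w| <= e & p.[u] - p.[v] = p^`().[c] * (u - v).
Proof.
wlog uv : u v / u <= v => [hw|] ue ve.
  case: (leP u v) => [|/ltW] uv; first exact: hw.
  have [c ce E] := hw v u uv ve ue; exists c => //; lra.
move: uv; rewrite le_eqVlt => /predU1P[<-|uv].
  by exists u; rewrite // !subrr mulr0.
have [c] := poly_mvt p uv; rewrite in_itv /= => /andP[uc cv] E.
exists c; last by lra.
by move: ue ve; rewrite !ler_distl => /andP[? ?] /andP[? ?]; apply/andP; split; lra.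
Qed.

Lemma poly_strict_deriv (R : rcfType) (p : {poly R}) (w eta : R) : 0 < eta ->
  exists2 e, 0 < e & forall u v, `|u - w| <= e -> `|v - w| <= e ->
    `|p.[u] - p.[v] - p^`().[w] * (u - v)| <= eta * `|u - v|.
Proof.
move=> eta0; have [d [d0 dP]] := poly_cont w p^`() eta0.
exists (d / 2) => [|u v ue ve]; first lra.
have [c ce ->] := poly_mvt_eq p ue ve.
rewrite -mulrBl normrM ler_wpM2r //; apply/ltW/dP.
by apply: le_lt_trans ce _; lra.
Qed.

Lemma poly_taylor2 (R : rcfType) (p : {poly R}) (w eta : R) :
  0 < eta -> p^`().[w] = 0 ->
  exists2 e, 0 < e & forall u, `|u - w| <= e ->
    `|p.[u] - p.[w] - p^`()^`().[w] / 2 * (u - w) ^+ 2| <= eta * (u - w) ^+ 2.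
Proof.
move=> eta0 pw; have [e e0 eP] := poly_strict_deriv p^`() w eta0.
exists e => // u ue; pose a := p^`()^`().[w].
pose g := p - (a / 2) *: (('X - w%:P) * ('X - w%:P)).
have [c cu E] := @poly_mvt_eq _ g u w w `|u - w| (lexx _)
  ltac:(by rewrite subrr normr0).
have gE v : g.[v] = p.[v] - a / 2 * (v - w) ^+ 2.
  by rewrite hornerD hornerN hornerZ hornerM hornerXsubC expr2.
have g'E v : g^`().[v] = p^`().[v] - a * (v - w).
  rewrite /g derivB derivZ derivM derivXsubC mul1r mulr1.
  rewrite hornerD hornerN hornerZ hornerD !hornerXsubC -mulr2n.
  by rewrite -[X in _ / _ * X]mulr_natl mulrA divfK ?pnatr_eq0.
move: E; rewrite !gE g'E subrr expr0n mulr0 subr0 => E.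
have -> : p.[u] - p.[w] - a / 2 * (u - w) ^+ 2 =
  (p^`().[c] - p^`().[w] - a * (c - w)) * (u - w) by rewrite pw; lra.
rewrite normrM -[in leRHS]real_normK ?num_real // expr2 mulrA ler_wpM2r //.
apply: le_trans (eP c w (le_trans cu ue) _) _; first by rewrite subrr normr0 ltW.
by rewrite ler_wpM2l // ltW.
Qed.

(** * First and second order consequences of the power sum constraints *)

(** The minimum of the radii works; starting it from 1 covers an empty [I]. *)
Lemma fin_radius (R : realDomainType) (I : finType) (Q : I -> R -> Prop) :
  (forall i a b, a <= b -> Q i b -> Q i a) ->
  (forall i, exists2 e, 0 < e & Q i e) ->
  exists2 e, 0 < e & forall i, Q i e.
Proof.
move=> Qmono Qex.
have [e eP] : {e : I -> R & forall i, 0 < e i /\ Q i (e i)}.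
  by apply: (@boolp.choice _ _ (fun i a => 0 < a /\ Q i a)) => i; have [a a0 Qa] := Qex i; exists a.
exists (\big[Num.min/1]_i e i) => [|i].
  by apply: lt_bigmin => [|i _]; [exact: ltr01 | have [] := eP i].
apply: Qmono (proj2 (eP i)); exact: bigmin_le_cond.
Qed.

Lemma psum_horner (R : realType) (K : nat) (alpha : 'I_K -> R) (p : {poly R})
    (m : nat) (theta : 'rV[R]_K) : (size p <= m)%N ->
  \sum_(j < K) alpha j * p.[theta 0 j] = \sum_(l < m) p`_l * psum alpha l theta.
Proof.
move=> pm; under eq_bigr do rewrite (horner_coef_wide _ pm) mulr_sumr.
rewrite exchange_big; apply: eq_bigr => l _; rewrite mulr_sumr.
by apply: eq_bigr => j _; rewrite mulrCA.
Qed.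

Lemma psum0 (R : realType) (K : nat) (alpha : 'I_K -> R) (theta : 'rV[R]_K) :
  psum alpha 0 theta = \sum_(j < K) alpha j.
Proof. by apply: eq_bigr => j _; rewrite expr0 mulr1. Qed.

(** The coefficients of index 1 to [n] are killed by the constraints, and the constant one because
    p_0 is the sum of the weights at every point. *)
Lemma psum_variety_horner (R : realType) (K n : nat) (alpha : 'I_K -> R)
    (x theta : 'rV[R]_K) (p : {poly R}) :
  psum_variety alpha x n theta -> (size p <= n.+2)%N ->
  \sum_(j < K) alpha j * (p.[theta 0 j] - p.[x 0 j]) =
  p`_n.+1 * (psum alpha n.+1 theta - psum alpha n.+1 x).
Proof.
move=> xth pn; under eq_bigr do rewrite mulrBr.
rewrite sumrB !(psum_horner _ _ pn) -sumrB big_ord_recr /= mulrBr big1 ?add0r //.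
move=> [[|l] /= ln] _; first by rewrite !psum0 subrr.
by rewrite xth ?subrr.
Qed.

Lemma psum_variety_horner_eq (R : realType) (K n : nat) (alpha : 'I_K -> R)
    (x theta : 'rV[R]_K) (p : {poly R}) :
  psum_variety alpha x n theta -> (size p <= n.+1)%N ->
  \sum_(j < K) alpha j * (p.[theta 0 j] - p.[x 0 j]) = 0.
Proof.
move=> xth pn; rewrite (psum_variety_horner xth) ?(leqW pn) //.
by rewrite nth_default ?mul0r.
Qed.

(* A Lagrange antiderivative [p k] has derivative 1 at [w k] and 0 at the other
   nodes, so the constraint [sum_j alpha j * (p k).[z_j] = const] isolates, to
   first order, the displacement of the coordinates sitting at [w k]. *)
Lemma block_estimate (R : realType) (K n : nat) (alpha : 'I_K -> R)
    (w : 'I_n -> R) (z0 : 'rV[R]_K) : injective w ->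
  exists2 C, 0 <= C & forall eta, 0 < eta -> exists2 e, 0 < e &
    forall z z' : 'rV[R]_K, (forall j, `|z 0 j - z0 0 j| <= e) ->
      (forall j, `|z' 0 j - z0 0 j| <= e) -> psum_variety alpha z' n z ->
      forall k, `|\sum_(j < K | z0 0 j == w k) alpha j * (z 0 j - z' 0 j)| <=
        \sum_(j < K) (eta + C * (z0 0 j \notin codom w)%:R) * `|z 0 j - z' 0 j|.
Proof.
move=> w_inj; have [p psize pw] := lagrange_primitive w_inj.
pose A := 1 + \sum_j `|alpha j|.
have leA j : `|alpha j| <= A.
  by rewrite /A (bigD1 j) //= addrCA lerDl addr_ge0 ?ler01 ?sumr_ge0.
have A0 : 0 < A by rewrite ltr_pwDl ?sumr_ge0.
pose D := \sum_k \sum_j `|(p k)^`().[z0 0 j]|.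
have leD k j : `|(p k)^`().[z0 0 j]| <= D.
  rewrite /D (bigD1 k) //= (bigD1 j) //= -addrA lerDl.
  by rewrite addr_ge0 ?sumr_ge0 // => i _; rewrite sumr_ge0.
have D0 : 0 <= D by rewrite sumr_ge0 // => i _; rewrite sumr_ge0.
(* At a coordinate of [z0] that is not a node, the derivative of [p k] is merely bounded by [D],
   while [A] bounds the weights. *)
exists (A * D) => [|eta eta0]; first by rewrite mulr_ge0 // ltW.
have [] := @fin_radius R ('I_n * 'I_K)%type (fun i e =>
    forall u v, `|u - z0 0 i.2| <= e -> `|v - z0 0 i.2| <= e ->
    `|(p i.1).[u] - (p i.1).[v] - (p i.1)^`().[z0 0 i.2] * (u - v)| <=
       eta / A * `|u - v|).
- by move=> i a b ab h u v ua va; apply: h; apply: le_trans ab.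
- by move=> i; apply: poly_strict_deriv; rewrite divr_gt0.
move=> e e0 eP; exists e => // z z' ze z'e zz' k.
have := psum_variety_horner_eq zz' (psize k).
pose err j := (p k).[z 0 j] - (p k).[z' 0 j] - (p k)^`().[z0 0 j] * (z 0 j - z' 0 j).
(* Three contributions: the linear term at the node [w k], the nonlinear error, and the linear term
   of the coordinates off the nodes. *)
have pE j : alpha j * ((p k).[z 0 j] - (p k).[z' 0 j]) =
    (if z0 0 j == w k then alpha j * (z 0 j - z' 0 j) else 0) +
    (alpha j * err j + alpha j * (if z0 0 j \notin codom w then
       (p k)^`().[z0 0 j] * (z 0 j - z' 0 j) else 0)).
  case: codomP => [[i E]|h] /=.
    have : (p k)^`().[z0 0 j] = (z0 0 j == w k)%:R.
      by rewrite E pw (inj_eq w_inj) eq_sym.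
    by rewrite /err; case: eqP => _ -> /=; ring.
  case: eqP => [E|_]; last by rewrite /err; ring.
  by case: h; exists k.
under eq_bigr do rewrite pE.
rewrite big_split /= -big_mkcond /= => /eqP; rewrite addr_eq0 => /eqP ->.
rewrite normrN; apply: le_trans (ler_norm_sum _ _ _) _; apply: ler_sum => j _.
apply: le_trans (ler_normD _ _) _; rewrite mulrDl; apply: lerD.
  have := eP (k, j) _ _ (ze j) (z'e j); rewrite normrM -/(err j) => h.
  apply: le_trans (ler_pM _ _ (leA j) h) _ => //.
  by rewrite mulrA mulrCA divff ?mulr1 // gt_eqF.
case: (z0 0 j \in codom w); rewrite /= ?mulr0 ?normr0 ?mul0r //.
by rewrite mulr1 !normrM mulrA ler_wpM2r // ler_pM.
Qed.

(** The leading coefficient turns [psum_variety_horner] into a formula for the variation of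
    p_(n+1). *)
Lemma nodal_primitive (R : numFieldType) (n : nat) (w : 'I_n -> R) :
  exists p : {poly R}, [/\ p^`() = \prod_i ('X - (w i)%:P), (size p <= n.+2)%N
    & p`_n.+1 = n.+1%:R^-1].
Proof.
set q := \prod_i _; have [p pq ps] := poly_primitive q.
have sq : size q = n.+1.
  by rewrite /q size_prod_XsubC /index_enum -enumT size_enum_ord.
exists p; split; rewrite ?(leq_trans ps) ?sq //.
have : q \is monic by apply: monic_prod_XsubC.
have n0 : n.+1%:R != 0 :> R by rewrite pnatr_eq0.
rewrite monicE lead_coefE sq /= -pq coef_deriv -[X in X == _]mulr_natr => /eqP h.
by rewrite -[LHS](mulfK n0) h mul1r.
Qed.

Lemma fin_pos_lower_bound (R : realDomainType) (I : finType) (alpha : I -> R) :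
  (forall j, 0 < alpha j) -> exists2 a, 0 < a & forall j, a <= alpha j.
Proof.
move=> alpha0; apply: (@fin_radius _ _ (fun j a => a <= alpha j)) => [j a b|j].
  exact: le_trans.
by exists (alpha j).
Qed.

Lemma fin_norm_upper_bound (R : realDomainType) (I : finType) (b : I -> R) :
  exists2 M, 0 < M & forall j, `|b j| <= M.
Proof.
exists (1 + \sum_j `|b j|) => [|j]; first by rewrite ltr_pwDl ?sumr_ge0.
by rewrite (bigD1 j) //= addrCA lerDl addr_ge0 ?sumr_ge0.
Qed.

(** The first order terms vanish, since every coordinate of [x] is a root of the nodal
    polynomial. *)
Lemma psum_second_order (R : realType) (K n : nat) (alpha : 'I_K -> R)
    (w : 'I_n -> R) (x : 'rV[R]_K) : (forall j, x 0 j \in codom w) ->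
  exists p : {poly R},
    (forall theta, psum_variety alpha x n theta ->
      psum alpha n.+1 theta - psum alpha n.+1 x =
      n.+1%:R * \sum_(j < K) alpha j * (p.[theta 0 j] - p.[x 0 j])) /\
    (forall eta, 0 < eta -> exists2 e, 0 < e &
      forall j u, `|u - x 0 j| <= e ->
      `|p.[u] - p.[x 0 j] - (\prod_i ('X - (w i)%:P))^`().[x 0 j] / 2 *
          (u - x 0 j) ^+ 2| <= eta * (u - x 0 j) ^+ 2).
Proof.
move=> xw; have [p [pq ps pl]] := nodal_primitive w; exists p.
split=> [theta th|eta eta0].
  by rewrite (psum_variety_horner th) // pl mulrA divff ?mul1r ?pnatr_eq0.
rewrite -pq; apply: (@fin_radius _ 'I_K (fun j e => forall u, `|u - x 0 j| <= e -> _)).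
  by move=> j a b ab h u ua; apply: h; apply: le_trans ab.
move=> j; apply: poly_taylor2 => //; rewrite pq.
have /codomP[i ->] := xw j.
by rewrite horner_prod (bigD1 i) //= !hornerE subrr mul0r.
Qed.

(** If only one coordinate of a block moves, the block sum in [block_estimate] is this single
    displacement. The condition on [k] covers both simple values and frozen duplicates. *)
Lemma singleton_block_bound (R : realType) (K n : nat) (alpha : 'I_K -> R)
    (w : 'I_n -> R) (x : 'rV[R]_K) (rho : R) :
  (forall j, 0 < alpha j) -> injective w -> (forall j, x 0 j \in codom w) ->
  0 < rho ->
  exists2 e, 0 < e & forall theta : 'rV[R]_K,
    (forall j, `|theta 0 j - x 0 j| <= e) -> psum_variety alpha x n theta ->
    forall j D, (forall k, x 0 k = x 0 j -> k != j -> theta 0 k = x 0 k) ->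
      (forall k, `|theta 0 k - x 0 k| <= D) -> `|theta 0 j - x 0 j| <= rho * D.
Proof.
move=> alpha0 w_inj xw rho0.
have [C _ hC] := block_estimate alpha x w_inj.
have [a a0 aP] := fin_pos_lower_bound alpha0.
(* The [K] error terms [eta * D] then sum to at most [rho * a * D], where [a] bounds the weights
   from below. *)
pose eta := rho * a / K.+1%:R.
have eta0 : 0 < eta by rewrite divr_gt0 ?mulr_gt0.
have [e e0 eP] := hC _ eta0; exists e => // theta the th j D only leD.
have /codomP[i xji] := xw j.
have xe k : `|x 0 k - x 0 k| <= e by rewrite subrr normr0 ltW.
have := eP theta x the xe th i.
rewrite (bigD1 j) ?xji //= big1 ?addr0 => [|k /andP[/eqP xk kj]]; last first.
  by rewrite only ?subrr ?mulr0 // xk xji.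
have D0 : 0 <= D by apply: le_trans (leD j).
rewrite -xji normrM gtr0_norm // => h.
have h2 : alpha j * `|theta 0 j - x 0 j| <= rho * a * D.
  apply: le_trans h _; apply: (@le_trans _ _ (\sum_(k < K) eta * D)).
    apply: ler_sum => k _; rewrite xw /= mulr0 addr0.
    by rewrite ler_wpM2l // ltW.
  rewrite sumr_const card_ord -mulr_natr /eta.
  have -> : rho * a / K.+1%:R * D * K%:R = rho * a * D * (K%:R / K.+1%:R) by ring.
  rewrite ler_piMr ?ler_pdivrMr ?mul1r ?ler_nat //.
  by rewrite mulr_ge0 // ltW // mulr_gt0.
rewrite -(ler_pM2l a0); apply: le_trans (_ : alpha j * `|theta 0 j - x 0 j| <= _).
  by rewrite ler_wpM2r.
by apply: le_trans h2 _; rewrite mulrCA mulrA.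
Qed.

(** Consider the largest displacement [D]. If it occurs in [N], then [rho < 1] forces [D = 0];
    otherwise its term, at least [mu * D ^+ 2], outweighs all the others, each at least
    [- (M * (rho * D) ^+ 2)]. *)
Lemma perturbed_form_ge0 (R : realDomainType) (K : nat) (g d : 'I_K -> R)
    (N : pred 'I_K) (mu M rho : R) :
  0 <= mu -> 0 <= M -> 0 <= rho -> rho < 1 -> M * K%:R * rho ^+ 2 <= mu ->
  (forall j, ~~ N j -> mu * d j ^+ 2 <= g j) ->
  (forall j, N j -> - (M * d j ^+ 2) <= g j) ->
  (forall j D, N j -> (forall k, `|d k| <= D) -> `|d j| <= rho * D) ->
  0 <= \sum_j g j.
Proof.
move=> mu0 M0 rho0 rho1 hmu gP gN dN.
case: K g d N hmu gP gN dN => [|K] g d N hmu gP gN dN; first by rewrite big_ord0.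
have [k0 _ k0P] := @arg_maxP _ R 'I_K.+1 ord0 predT (fun k => `|d k|) isT.
set D := `|d k0|; have {k0P} leD k : `|d k| <= D by exact: k0P.
have D0 : 0 <= D by apply: normr_ge0.
have sqd j : d j ^+ 2 = `|d j| ^+ 2 by rewrite real_normK ?num_real.
have gN' j : N j -> - (M * (rho * D) ^+ 2) <= g j.
  move=> Nj; apply: le_trans (gN j Nj); rewrite lerN2 ler_wpM2l // sqd.
  by rewrite ler_pXn2r ?nnegrE ?mulr_ge0 // dN.
have gge j : j != k0 -> - (M * (rho * D) ^+ 2) <= g j.
  move=> _; case: (boolP (N j)) => [/gN' //|/gP]; apply: le_trans.
  apply: (@le_trans _ _ 0); first by rewrite oppr_le0 mulr_ge0 ?sqr_ge0.
  by rewrite mulr_ge0 ?sqr_ge0.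
have [Nk|Pk] := boolP (N k0).
  have Dle : D <= rho * D by apply: dN.
  have D00 : D = 0.
    apply/eqP; rewrite eq_le D0 andbT -(@pmulr_rle0 _ (1 - rho)) ?subr_gt0 //.
    by rewrite mulrBl mul1r subr_le0.
  apply: sumr_ge0 => j _; have [->|jk] := eqVneq j k0.
    by apply: le_trans (gN' _ Nk); rewrite D00 mulr0 expr0n /= mulr0 oppr0.
  by apply: le_trans (gge _ jk); rewrite D00 mulr0 expr0n /= mulr0 oppr0.
rewrite (bigD1 k0) //=; apply: le_trans (_ : mu * D ^+ 2 + \sum_(i < K.+1 | i != k0) - (M * (rho * D) ^+ 2) <= _); last first.
  apply: lerD; first by rewrite -sqd gP.
  exact: ler_sum.
rewrite sumr_const (cardC1 k0) card_ord /= mulNrn subr_ge0 -mulr_natr exprMn.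
have -> : M * (rho ^+ 2 * D ^+ 2) * K%:R = M * K%:R * rho ^+ 2 * D ^+ 2 by ring.
rewrite ler_wpM2r ?sqr_ge0 //; apply: le_trans hmu.
by rewrite ler_wpM2r ?sqr_ge0 // ler_wpM2l // ler_nat.
Qed.

(** A second derivative test in which the directions of the wrong sign are harmless: their
    coordinates are alone in their block, so [singleton_block_bound] makes them move negligibly. *)
Lemma psum_local_extremum (R : realType) (K n : nat) (alpha : 'I_K -> R)
    (w : 'I_n -> R) (x : 'rV[R]_K) (s : R) :
  (forall j, 0 < alpha j) -> injective w -> (forall j, x 0 j \in codom w) ->
  s != 0 ->
  (forall j, s * (\prod_i ('X - (w i)%:P))^`().[x 0 j] < 0 ->
    forall k, x 0 k = x 0 j -> k = j) ->
  (forall j, (\prod_i ('X - (w i)%:P))^`().[x 0 j] != 0) ->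
  exists2 e, 0 < e & forall theta : 'rV[R]_K,
    (forall j, `|theta 0 j - x 0 j| <= e) -> psum_variety alpha x n theta ->
    0 <= s * (psum alpha n.+1 theta - psum alpha n.+1 x).
Proof.
move=> alpha0 w_inj xw s0 single q0; set q := \prod_i _ in single q0.
have [p [pE pT]] := psum_second_order alpha xw; rewrite -/q in pT.
pose c j := alpha j * (s * q^`().[x 0 j]).
have c0 j : 0 < `|c j| by rewrite normr_gt0 !mulf_neq0 // gt_eqF.
have [mu mu0 muP] := fin_pos_lower_bound c0.
have [A A0 AP] := fin_norm_upper_bound alpha.
have [M M0 MP] := fin_norm_upper_bound c.
(* The Taylor error then costs at most [mu / 4] per squared displacement, out of the [mu / 2]
   granted by a positive [c j / 2]. *)
pose eta := mu / (4 * A * `|s|).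
have s0' : 0 < `|s| by rewrite normr_gt0.
have eta0 : 0 < eta by rewrite divr_gt0 ?mulr_gt0.
pose B := M + mu.
have B0 : 0 < B by rewrite addr_gt0.
(* As [rho <= 1], the product [B * K * rho ^+ 2] is at most [rho * (B * K.+1)], hence at most
   [mu / 4]. *)
pose rho := Num.min (1 / 2) (mu / 4 / (B * K.+1%:R)).
have BK0 : 0 < B * K.+1%:R by rewrite mulr_gt0.
have rho0 : 0 < rho.
  by rewrite lt_min !divr_gt0 //= ?ltr01.
have rho12 : rho <= 1 / 2 by rewrite ge_min lexx.
have [e1 e10 e1P] := pT _ eta0.
have [e2 e20 e2P] := singleton_block_bound alpha0 w_inj xw rho0.
exists (Num.min e1 e2) => [|theta the th]; first by rewrite lt_min e10.
have the1 j : `|theta 0 j - x 0 j| <= e1 by apply: le_trans (the j) _; rewrite ge_min lexx.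
have the2 j : `|theta 0 j - x 0 j| <= e2 by apply: le_trans (the j) _; rewrite ge_min lexx orbT.
rewrite pE // mulrCA pmulr_rge0 // mulr_sumr.
pose d j := theta 0 j - x 0 j.
have gE j : `|s * (alpha j * (p.[theta 0 j] - p.[x 0 j])) - c j / 2 * d j ^+ 2|
    <= mu / 4 * d j ^+ 2.
  have -> : s * (alpha j * (p.[theta 0 j] - p.[x 0 j])) - c j / 2 * d j ^+ 2 =
    s * alpha j * (p.[theta 0 j] - p.[x 0 j] - q^`().[x 0 j] / 2 * d j ^+ 2).
    by rewrite /c; ring.
  rewrite normrM; apply: le_trans (ler_wpM2l _ (e1P j _ (the1 j))) _ => //.
  rewrite -/(d j) mulrA ler_wpM2r ?sqr_ge0 // normrM.
  apply: le_trans (_ : `|s| * A * eta <= _).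
    by rewrite ler_wpM2r ?(ltW eta0) // ler_wpM2l.
  rewrite /eta le_eqVlt; apply/orP; left; apply/eqP.
  by field; rewrite !gt_eqF.
have sq0 j : 0 <= d j ^+ 2 by apply: sqr_ge0.
apply: (@perturbed_form_ge0 _ _ _ d (fun j => c j < 0) (mu / 4) B rho).
- by rewrite ltW // divr_gt0.
- exact: ltW.
- exact: ltW.
- by apply: le_lt_trans rho12 _; lra.
- have h : rho <= mu / 4 / (B * K.+1%:R) by rewrite ge_min lexx orbT.
  rewrite ler_pdivlMr // in h.
  apply: le_trans h; rewrite expr2 mulrA mulrC.
  rewrite ler_wpM2l ?(ltW rho0) //.
  apply: le_trans (_ : B * K%:R * 1 <= _); last by rewrite mulr1 ler_wpM2l ?(ltW B0) ?ler_nat.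
  rewrite ler_wpM2l ?mulr_ge0 ?(ltW B0) //.
  by apply: le_trans rho12 _; lra.
- move=> j; rewrite -leNgt => cj; have := gE j; have := muP j.
  rewrite ger0_norm // ler_distl => muc /andP[+ _]; apply: le_trans.
  by rewrite -mulrBl ler_wpM2r //; lra.
- move=> j cj; have := gE j; have := MP j.
  rewrite ltr0_norm // ler_distl => muc /andP[+ _]; apply: le_trans.
  by rewrite -mulrBl -mulNr ler_wpM2r // /B; lra.
- move=> j D cj leD; apply: e2P => // k xkj /eqP[]; apply: single => //.
  by move: cj; rewrite /c pmulr_rlt0.
Qed.

(** * Curves in the variety *)

(* Row vectors are both complete and normed, but the library does not declare the
   join of the two structures. *)
HB.instance Definition _ (R : realType) (n : nat) := Complete.on 'rV[R]_n.

Lemma rV_norm_leP (R : realType) (n : nat) (v : 'rV[R]_n) (c : R) : 0 <= c ->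
  reflect (forall i, `|v 0 i| <= c) (`|v| <= c).
Proof.
move=> c0; rewrite -[`|v|]/(mx_norm v) mx_normrE.
apply: (iffP idP) => [/bigmax_leP[_ h] i|h]; first exact: (h (ord0, i)).
by apply/bigmax_leP; split=> // -[i j] _ /=; rewrite ord1.
Qed.

(** Banach fixed point theorem on the closed ball of radius [rho], which is stable because the ratio
    1/2 and the bound on [F 0] each use half of the radius. *)
Lemma rV_contraction (R : realType) (n : nat) (F : 'rV[R]_n -> 'rV[R]_n) (rho : R) :
  0 <= rho ->
  (forall d d', `|d| <= rho -> `|d'| <= rho -> `|F d - F d'| <= 1 / 2 * `|d - d'|) ->
  `|F 0| <= rho / 2 ->
  exists2 d, `|d| <= rho & d = F d.
Proof.
move=> rho0 Flip F0; pose U := [set d : 'rV[R]_n | `|d| <= rho].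
have U0 : U 0 by rewrite /U /= normr0.
have FU : set_fun U U F.
  move=> d Ud; have := Flip d 0 Ud U0; rewrite subr0 => h.
  rewrite /U /= -[F d](subrK (F 0)); apply: le_trans (ler_normD _ _) _.
  by have : `|d| <= rho by []; lra.
have half_ge0 : (0 : R) <= 1 / 2 by lra.
have ctr : is_contraction (mkfun_fun FU).
  exists (NngNum half_ge0); split => /=; first lra.
  by move=> [d d'] [/= Ud Ud']; apply: Flip.
have clU : closed U.
  have -> : U = closed_ball_ (fun v : 'rV[R]_n => `|v|) 0 rho.
    by apply/seteqP; split => d; rewrite /U /closed_ball_ /= sub0r normrN.
  exact: closed_closed_ball_.
have [d Ud dE] := banach_fixed_point ctr clU (ex_intro _ 0 U0).
by exists d.
Qed.

Lemma deriv_eq0_const (R : rcfType) (g : {poly R}) (u v : R) :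
  g^`() = 0 -> g.[u] = g.[v].
Proof.
move=> g0; have [||c _] := @poly_mvt_eq _ g u v 0 (`|u| + `|v|).
- by rewrite subr0 lerDl.
- by rewrite subr0 lerDr.
by rewrite g0 horner0 mul0r => /subr0_eq.
Qed.

(** Subtracting from ['X^l] the combination of the [p i] with coefficients [l * w i ^ (l - 1)]
    leaves a polynomial whose derivative has size at most [n] and vanishes at the [n] nodes, hence a
    constant. *)
Lemma psum_variety_lagrange (R : realType) (K n : nat) (alpha : 'I_K -> R)
    (w : 'I_n -> R) (p : 'I_n -> {poly R}) (x theta : 'rV[R]_K) :
  injective w -> (forall i, (size (p i) <= n.+1)%N) ->
  (forall i k, (p i)^`().[w k] = (i == k)%:R) ->
  (forall i, \sum_(j < K) alpha j * ((p i).[theta 0 j] - (p i).[x 0 j]) = 0) ->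
  psum_variety alpha x n theta.
Proof.
move=> w_inj ps pw h l /andP[l0 ln].
pose c i := l%:R * w i ^+ l.-1.
pose g : {poly R} := 'X^l - \sum_i c i *: p i.
have g'0 : g^`() = 0.
  apply: (@roots_geq_poly_eq0 _ _ (codom w)).
  - apply/allP => _ /codomP[k ->]; rewrite /root /g derivB derivXn raddf_sum.
    rewrite hornerD hornerN hornerMn hornerXn horner_sum (bigD1 k) //= big1.
      by rewrite derivZ hornerZ pw eqxx mulr1 addr0 /c mulr_natl subrr.
    by move=> i ik; rewrite derivZ hornerZ pw (negPf ik) mulr0.
  - by rewrite map_inj_uniq ?enum_uniq.
  - rewrite size_codom card_ord; apply: leq_trans (size_poly _ _) _.
    rewrite -subn1 leq_subLR add1n; apply: leq_trans (size_polyD _ _) _.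
    rewrite geq_max size_polyXn ltnS ln size_polyN.
    apply: leq_trans (size_sum _ _ _) _; apply/bigmax_leqP => i _.
    exact: leq_trans (size_scale_leq _ _) (ps i).
have gE : \sum_(j < K) alpha j * (g.[theta 0 j] - g.[x 0 j]) = 0.
  by apply: big1 => j _; rewrite (deriv_eq0_const _ (x 0 j)) // subrr mulr0.
apply/eqP; rewrite -subr_eq0 -sumrB; apply/eqP; rewrite -[RHS]gE.
rewrite -[LHS]subr0 -[X in _ - X](@big1 R 0 +%R 'I_n (index_enum _) xpredT
  (fun i => c i * \sum_(j < K) alpha j * ((p i).[theta 0 j] - (p i).[x 0 j]))); last first.
  by move=> i _; rewrite h mulr0.
under [X in _ - X]eq_bigr do rewrite mulr_sumr.
rewrite exchange_big -sumrB; apply: eq_bigr => j _.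
rewrite /g !hornerD !hornerN !hornerXn !horner_sum -mulrBr.
under eq_bigr do rewrite mulrCA.
rewrite -mulr_sumr -mulrBr; congr (_ * _).
under [in RHS]eq_bigr do rewrite hornerZ.
under [X in _ = _ - (_ - X)]eq_bigr do rewrite hornerZ.
have -> : \sum_(i < n) c i * ((p i).[theta 0 j] - (p i).[x 0 j]) =
    \sum_i c i * (p i).[theta 0 j] - \sum_i c i * (p i).[x 0 j].
  by rewrite -sumrB; apply: eq_bigr => i _; rewrite mulrBr.
by ring.
Qed.

(* For small t the n constraints are solved for the n coordinates r i by a
   simplified Newton iteration, the coordinate a being shifted by t. *)
Lemma psum_variety_curve (R : realType) (K n : nat) (alpha : 'I_K -> R)
    (x : 'rV[R]_K) (r : 'I_n -> 'I_K) (a : 'I_K) :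
  (forall j, 0 < alpha j) -> injective (fun i => x 0 (r i)) -> a \notin codom r ->
  exists C delta, [/\ 0 < C, 0 < delta & forall t, `|t| <= delta ->
    exists theta : 'rV[R]_K, [/\ psum_variety alpha x n theta,
      theta 0 a = x 0 a + t, forall j, `|theta 0 j - x 0 j| <= C * `|t|
      & forall j, j \notin codom r -> j != a -> theta 0 j = x 0 j]].
Proof.
move=> alpha0 w_inj ar; pose w i := x 0 (r i).
have r_inj : injective r by move=> i k /(congr1 (x 0)); apply: w_inj.
have [p ps pw] := lagrange_primitive w_inj.
have [b b0 bP] := fin_pos_lower_bound alpha0.
have [A A0 AP] := fin_norm_upper_bound alpha.
pose eta := b / (2 * A * K.+1%:R).
have K0 : (0 : R) < K.+1%:R by [].
have eta0 : 0 < eta by rewrite divr_gt0 ?mulr_gt0.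
have [e e0 eP] : exists2 e, 0 < e & forall i k u v,
    `|u - w k| <= e -> `|v - w k| <= e ->
    `|(p i).[u] - (p i).[v] - (i == k)%:R * (u - v)| <= eta * `|u - v|.
  have [] := @fin_radius R ('I_n * 'I_n)%type (fun i e => forall u v,
    `|u - w i.2| <= e -> `|v - w i.2| <= e ->
    `|(p i.1).[u] - (p i.1).[v] - (i.1 == i.2)%:R * (u - v)| <= eta * `|u - v|).
  - by move=> i c d cd h u v ua va; apply: h; apply: le_trans cd.
  - by move=> [i k] /=; rewrite -pw; apply: poly_strict_deriv.
  by move=> e e0 eP; exists e => // i k; apply: (eP (i, k)).
have [B [B0 [e' e'0 BP]]] : exists B, 0 < B /\ exists2 e, 0 < e & forall i t,
    `|t| <= e -> `|(p i).[x 0 a + t] - (p i).[x 0 a]| <= B * `|t|.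
  have [B B0 BP] := fin_norm_upper_bound (fun i => (p i)^`().[x 0 a]).
  exists (B + 1); split; first by rewrite addr_gt0.
  have [] := @fin_radius R 'I_n (fun i e => forall t,
    `|t| <= e -> `|(p i).[x 0 a + t] - (p i).[x 0 a]| <= (B + 1) * `|t|).
  - by move=> i c d cd h u ua; apply: h; apply: le_trans cd.
  - move=> i; have [d d0 dP] := poly_strict_deriv (p i) (x 0 a) ltr01.
    exists d => // t td; have := dP (x 0 a + t) (x 0 a).
    rewrite subrr normr0 addrC addKr => /(_ td (ltW d0)) h.
    rewrite -[X in `|X|](subrK ((p i)^`().[x 0 a] * t)).
    apply: le_trans (ler_normD _ _) _; rewrite mulrDl addrC lerD //.
    by rewrite normrM ler_wpM2r.
  by move=> d d0 dP; exists d.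
(* Displacement of the coordinates: [t] at [a], the unknown [d 0 i] at [r i], and 0 elsewhere. *)
pose D (t : R) (d : 'rV[R]_n) (j : 'I_K) : R :=
  if j == a then t else if [pick i | r i == j] is Some i then d 0 i else 0.
have Da t d : D t d a = t by rewrite /D eqxx.
have ra i : r i != a by apply: contraNneq ar => <-; apply: codom_f.
have Dr t d i : D t d (r i) = d 0 i.
  rewrite /D (negPf (ra i)); case: pickP => [k /eqP/r_inj -> //|/(_ i)].
  by rewrite eqxx.
have Dn t d j : j \notin codom r -> j != a -> D t d j = 0.
  move=> jr ja; rewrite /D (negPf ja); case: pickP => // i /eqP E.
  by case/negP: jr; rewrite -E codom_f.
pose S t (d : 'rV[R]_n) i := \sum_j alpha j * ((p i).[x 0 j + D t d j] - (p i).[x 0 j]).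
(* By the choice of [p], the Jacobian of [S t] at [d = 0] is diagonal with entries [alpha (r i)];
   its inverse gives the Newton step. *)
pose F t (d : 'rV[R]_n) : 'rV[R]_n := \row_i (d 0 i - (alpha (r i))^-1 * S t d i).
(* The first summand keeps [F t 0] within half of the ball; the summand 1 makes the shift [t] of the
   coordinate [a] obey the same bound. *)
pose C := 2 * A * B / b + 1.
have C0 : 0 < C by rewrite addr_gt0 // divr_gt0 ?mulr_gt0.
exists C, (Num.min e' (e / C)); split=> //; first by rewrite lt_min e'0 divr_gt0.
move=> t; rewrite le_min => /andP[te' teC].
have rho0 : 0 <= C * `|t| by rewrite mulr_ge0 // ltW.
have rhoe : C * `|t| <= e by rewrite mulrC -ler_pdivlMr.
have [||d dle dF] := @rV_contraction R n (F t) (C * `|t|) rho0.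
- move=> d d' /(rV_norm_leP _ rho0) dle /(rV_norm_leP _ rho0) d'le.
  apply/rV_norm_leP; first by rewrite mulr_ge0 //; lra.
  move=> i; rewrite !mxE.
  have -> : d 0 i - (alpha (r i))^-1 * S t d i - (d' 0 i - (alpha (r i))^-1 * S t d' i)
    = - (alpha (r i))^-1 * \sum_j alpha j *
        ((p i).[x 0 j + D t d j] - (p i).[x 0 j + D t d' j] -
         (j == r i)%:R * (D t d j - D t d' j)).
    transitivity (- (alpha (r i))^-1 * (S t d i - S t d' i -
      alpha (r i) * (d 0 i - d' 0 i))).
      by field; rewrite gt_eqF.
    congr (_ * _); rewrite /S -sumrB.
    have -> : alpha (r i) * (d 0 i - d' 0 i) =
        \sum_j alpha j * ((j == r i)%:R * (D t d j - D t d' j)).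
      rewrite (bigD1 (r i)) //= eqxx mul1r !Dr big1 ?addr0 // => j ji.
      by rewrite (negPf ji) mul0r mulr0.
    by rewrite -sumrB; apply: eq_bigr => j _; ring.
  rewrite normrM normrN normfV (gtr0_norm (alpha0 _)).
  rewrite mulrC ler_pdivrMr //; apply: le_trans (ler_norm_sum _ _ _) _.
  apply: (@le_trans _ _ (\sum_(j < K) A * (eta * `|d - d'|))).
    apply: ler_sum => j _; rewrite normrM; apply: ler_pM => //.
    have dd0 : 0 <= eta * `|d - d'| by rewrite mulr_ge0 // ltW.
    have [->|ja] := eqVneq j a.
      by rewrite !Da !subrr mulr0 subrr normr0.
    have [/codomP[k ->]|jr] := boolP (j \in codom r); last first.
      by rewrite !Dn // !subrr mulr0 subrr normr0.
    rewrite !Dr (inj_eq r_inj) eq_sym.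
    have -> : d 0 k - d' 0 k = x 0 (r k) + d 0 k - (x 0 (r k) + d' 0 k) by ring.
    apply: le_trans (eP i k _ _ _ _) _.
    - by rewrite addrC addKr (le_trans (dle k)).
    - by rewrite addrC addKr (le_trans (d'le k)).
    rewrite ler_wpM2l ?(ltW eta0) // addrAC opprD addrA subrr sub0r addrC.
    by have /rV_norm_leP := lexx `|d - d'| => /(_ (normr_ge0 _) k); rewrite !mxE.
  rewrite sumr_const card_ord -[X in X <= _]mulr_natr.
  have -> : A * (eta * `|d - d'|) * K%:R = 1 / 2 * `|d - d'| * (b * (K%:R / K.+1%:R)).
    by rewrite /eta; field; rewrite !gt_eqF.
  rewrite ler_wpM2l ?mulr_ge0 ?divr_ge0 //.
  apply: le_trans (bP _); rewrite ler_piMr ?(ltW b0) //.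
  by rewrite ler_pdivrMr // mul1r ler_nat.
- have half0 : 0 <= C * `|t| / 2 by rewrite divr_ge0.
  apply/rV_norm_leP => // i; rewrite !mxE sub0r normrN normrM normfV (gtr0_norm (alpha0 _)).
  have -> : S t 0 i = alpha a * ((p i).[x 0 a + t] - (p i).[x 0 a]).
    rewrite /S (bigD1 a) //= Da big1 ?addr0 // => j ja.
    have [/codomP[k ->]|jr] := boolP (j \in codom r); last first.
      by rewrite Dn // addr0 subrr mulr0.
    by rewrite Dr mxE addr0 subrr mulr0.
  rewrite normrM mulrC ler_pdivrMr //.
  apply: le_trans (_ : A * (B * `|t|) <= _); first by rewrite ler_pM // BP.
  apply: le_trans (_ : C * `|t| / 2 * b <= _); last by rewrite ler_wpM2l.
  have -> : C * `|t| / 2 * b = A * (B * `|t|) + `|t| / 2 * b.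
    by rewrite /C; field; rewrite gt_eqF.
  by rewrite lerDl mulr_ge0 ?divr_ge0 // ltW.
move/(rV_norm_leP _ rho0) in dle.
exists (\row_j (x 0 j + D t d j)); split.
- apply: (psum_variety_lagrange w_inj ps pw) => i.
  under eq_bigr do rewrite mxE.
  have /rowP/(_ i) := dF; rewrite mxE -[LHS]subr0 => /addrI/oppr_inj/esym/eqP.
  by rewrite mulf_eq0 invr_eq0 gt_eqF //= => /eqP.
- by rewrite mxE Da.
- move=> j; rewrite mxE addrC addKr; have [->|ja] := eqVneq j a.
    by rewrite Da ler_peMl // /C lerDr divr_ge0 ?mulr_ge0 // ltW.
  have [/codomP[k ->]|jr] := boolP (j \in codom r); first by rewrite Dr.
  by rewrite Dn // normr0.
- by move=> j jr ja; rewrite mxE Dn // addr0.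
Qed.

(** * Directions of increase and decrease *)

(** The curve shifts [a] by [t] against the representative of the same value. Every other block has
    at most one moving coordinate, negligible against [t], so the sign of the nodal derivative at
    [x 0 a] decides. *)
Lemma psum_saddle_direction (R : realType) (K n : nat) (alpha : 'I_K -> R)
    (w : 'I_n -> R) (x : 'rV[R]_K) (a b : 'I_K) (s : R) :
  (forall j, 0 < alpha j) -> injective w -> (forall j, x 0 j \in codom w) ->
  (forall i, exists j, x 0 j = w i) -> b != a -> x 0 b = x 0 a ->
  0 < s * (\prod_i ('X - (w i)%:P))^`().[x 0 a] ->
  forall e, 0 < e -> exists theta : 'rV[R]_K,
    [/\ forall j, `|theta 0 j - x 0 j| <= e, psum_variety alpha x n theta
      & 0 < s * (psum alpha n.+1 theta - psum alpha n.+1 x)].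
Proof.
move=> alpha0 w_inj xw wx ba xba sq0 e e0; set q := \prod_i _ in sq0.
(* Should [a] be the coordinate found for its own value, [b] replaces it. *)
have [r rP] : {r : 'I_n -> 'I_K & forall i, x 0 (r i) = w i /\ r i != a}.
  apply: (@boolp.choice _ _ (fun i j => x 0 j = w i /\ j != a)) => i.
  have [j jw] := wx i; have [ja|ja] := eqVneq j a; last by exists j.
  by exists b; split; rewrite // xba -ja.
have xr i : x 0 (r i) = w i by have [] := rP i.
have rw_inj : injective (fun i => x 0 (r i)) by move=> i k; rewrite !xr; apply: w_inj.
have ar : a \notin codom r.
  by apply/codomP => -[i ai]; have [_] := rP i; rewrite -ai eqxx.
have [C [delta [C0 delta0 curve]]] := psum_variety_curve alpha0 rw_inj ar.
have [p [pE pT]] := psum_second_order alpha xw; rewrite -/q in pT.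
pose c := s * q^`().[x 0 a].
have s0 : 0 < `|s|.
  by rewrite normr_gt0; apply: contraTneq sq0 => ->; rewrite mul0r ltxx.
have c0 : 0 < c by [].
pose eta := c / (4 * `|s|).
have eta0 : 0 < eta by apply: divr_gt0 => //; apply: mulr_gt0.
have [e1 e10 e1P] := pT _ eta0.
pose mu := alpha a * (c / 4).
have mu0 : 0 < mu by apply: mulr_gt0 => //; apply: divr_gt0.
have [M M0 MP] := fin_norm_upper_bound
  (fun j => alpha j * (`|s| * (`|q^`().[x 0 j]| / 2 + eta))).
(* Chosen so that the losses of the other blocks, at most [K] times [M * (rho * (C * t)) ^+ 2], stay
   below the gain [mu * t ^+ 2] at [a]. *)
pose rho := Num.min 1 (mu / (2 * (K.+1%:R * M * C ^+ 2))).
have den0 : 0 < 2 * (K.+1%:R * M * C ^+ 2) by rewrite !mulr_gt0 ?exprn_gt0.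
have rho0 : 0 < rho by rewrite lt_min ltr01 divr_gt0.
have rho1 : rho <= 1 by rewrite ge_min lexx.
have rhoP : K%:R * M * C ^+ 2 * rho ^+ 2 < mu.
  apply: le_lt_trans (_ : mu / 2 < _); last by lra.
  have : rho <= mu / (2 * (K.+1%:R * M * C ^+ 2)) by rewrite ge_min lexx orbT.
  rewrite ler_pdivlMr // => h.
  apply: le_trans (_ : rho * (K.+1%:R * M * C ^+ 2) <= _); last by lra.
  have rho2 : rho ^+ 2 <= rho by rewrite expr2 ler_piMl // ltW.
  have MC0 : 0 <= M * C ^+ 2 by rewrite mulr_ge0 ?sqr_ge0 // ltW.
  rewrite mulrC; apply: ler_pM => //; rewrite ?sqr_ge0 //.
    by rewrite -mulrA mulr_ge0.
  by rewrite -!mulrA ler_wpM2r // ler_nat.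
have [e2 e20 e2P] := singleton_block_bound alpha0 w_inj xw rho0.
pose m := Num.min (Num.min e1 e2) e.
have m0 : 0 < m by rewrite !lt_min e10 e20.
pose t := Num.min delta (m / C).
have t0 : 0 < t by rewrite lt_min delta0 divr_gt0.
have tn : `|t| = t by rewrite gtr0_norm.
have [|theta [th tha thd thx]] := curve t; first by rewrite tn ge_min lexx.
have thm j : `|theta 0 j - x 0 j| <= m.
  by apply: le_trans (thd j) _; rewrite tn mulrC -ler_pdivlMr // ge_min lexx orbT.
have [the1 [the2 the]] : (forall j, `|theta 0 j - x 0 j| <= e1) /\
   (forall j, `|theta 0 j - x 0 j| <= e2) /\ (forall j, `|theta 0 j - x 0 j| <= e).
  by split; [|split] => j; apply: le_trans (thm j) _; rewrite !ge_min lexx ?orbT.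
exists theta; split=> //.
rewrite pE // mulrCA pmulr_rgt0 // mulr_sumr (bigD1 a) //=.
pose d j := theta 0 j - x 0 j.
pose g j := s * (alpha j * (p.[theta 0 j] - p.[x 0 j])).
have gE j : `|g j - alpha j * (s * q^`().[x 0 j] / 2 * d j ^+ 2)|
    <= alpha j * (`|s| * (eta * d j ^+ 2)).
  have -> : g j - alpha j * (s * q^`().[x 0 j] / 2 * d j ^+ 2) =
    alpha j * (s * (p.[theta 0 j] - p.[x 0 j] - q^`().[x 0 j] / 2 * d j ^+ 2)).
    by rewrite /g; ring.
  by rewrite normrM gtr0_norm // ler_wpM2l ?(ltW (alpha0 _)) // normrM ler_wpM2l // e1P.
have gblock j : x 0 j = x 0 a -> alpha j * (c / 4 * d j ^+ 2) <= g j.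
  move=> xja; have := gE j; rewrite ler_distl => /andP[+ _]; apply: le_trans.
  rewrite -mulrBr ler_wpM2l ?(ltW (alpha0 _)) // [X in _ - X]mulrA -mulrBl ler_wpM2r ?sqr_ge0 //.
  rewrite xja -/c /eta; have -> : `|s| * (c / (4 * `|s|)) = c / 4.
    by field; rewrite gt_eqF.
  by lra.
have gother j : x 0 j != x 0 a -> - (M * (rho * (C * t)) ^+ 2) <= g j.
  move=> xja.
  have dj : `|d j| <= rho * (C * t).
    have [jr|jr] := boolP (j \in codom r); last first.
      have ja : j != a by apply: contraNneq xja => ->.
      by rewrite /d thx // subrr normr0 !mulr_ge0 // ltW.
    apply: e2P => //; last by move=> k; have := thd k; rewrite tn.
    move=> k xkj kj; apply: thx; last first.
      by apply: contraNneq xja => <-; rewrite xkj.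
    apply: contraNN kj => /codomP[i ki]; move/codomP: jr => [i' ji'].
    by rewrite ki ji'; apply/eqP; congr r; apply: rw_inj; rewrite -ki -ji'.
  apply: le_trans (_ : - (M * d j ^+ 2) <= _).
    rewrite lerN2 ler_wpM2l ?(ltW M0) // -(@real_normK _ (d j)) ?num_real //.
    by rewrite ler_pXn2r ?nnegrE ?mulr_ge0 // ltW.
  have := gE j; rewrite ler_distl => /andP[+ _]; apply: le_trans.
  apply: le_trans (_ : - (alpha j * (`|s| * (`|q^`().[x 0 j]| / 2 + eta)) * d j ^+ 2) <= _).
    rewrite lerN2 ler_wpM2r ?sqr_ge0 //.
    by apply: le_trans (MP j); apply: ler_norm.
  have : 0 <= alpha j * ((s * q^`().[x 0 j] + `|s| * `|q^`().[x 0 j]|) * (d j ^+ 2 / 2)).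
    rewrite mulr_ge0 ?(ltW (alpha0 _)) // mulr_ge0 ?divr_ge0 ?sqr_ge0 //.
    by rewrite -normrM -lerBlDr sub0r lerNl -normrN ler_norm.
  by lra.
apply: lt_le_trans (_ : mu * t ^+ 2 + \sum_(j < K | j != a) - (M * (rho * (C * t)) ^+ 2) <= _).
  rewrite sumr_const -mulr_natr mulNr subr_gt0.
  apply: le_lt_trans (_ : K%:R * M * C ^+ 2 * rho ^+ 2 * t ^+ 2 < _).
    have -> : K%:R * M * C ^+ 2 * rho ^+ 2 * t ^+ 2 = M * (rho * (C * t)) ^+ 2 * K%:R by ring.
    have X0 : 0 <= M * (rho * (C * t)) ^+ 2 by rewrite mulr_ge0 ?sqr_ge0 // ltW.
    apply: ler_wpM2l => //; rewrite ler_nat.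
    by rewrite -[X in (_ <= X)%N](card_ord K) max_card.
  by rewrite ltr_pM2r // exprn_gt0.
apply: lerD.
  have := gblock a erefl; rewrite /g /mu; apply: le_trans.
  by rewrite /d tha [x 0 a + t]addrC addrK -mulrA.
apply: ler_sum => j _; have [xja|/gother //] := eqVneq (x 0 j) (x 0 a).
apply: le_trans (gblock j xja); apply: (@le_trans _ _ 0).
  by rewrite oppr_le0 mulr_ge0 ?sqr_ge0 // ltW.
apply: mulr_ge0; first exact: ltW.
by apply: mulr_ge0; [apply: divr_ge0; rewrite // ltW | exact: sqr_ge0].
Qed.

(** The nodal polynomial of the [n] values at [r] does not vanish at [x 0 a], so p_(n+1) varies to
    first order along the curve shifting [a], with the sign of the shift. *)
Lemma psum_noncritical_direction (R : realType) (K n : nat) (alpha : 'I_K -> R)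
    (x : 'rV[R]_K) (r : 'I_n -> 'I_K) (a : 'I_K) (s : R) :
  (forall j, 0 < alpha j) -> injective (fun i => x 0 (r i)) ->
  (forall i, x 0 (r i) != x 0 a) -> s != 0 ->
  forall e, 0 < e -> exists theta : 'rV[R]_K,
    [/\ forall j, `|theta 0 j - x 0 j| <= e, psum_variety alpha x n theta
      & 0 < s * (psum alpha n.+1 theta - psum alpha n.+1 x)].
Proof.
move=> alpha0 rw_inj ra s0 e e0.
have ar : a \notin codom r.
  by apply/codomP => -[i ai]; have := ra i; rewrite -ai eqxx.
have [C [delta [C0 delta0 curve]]] := psum_variety_curve alpha0 rw_inj ar.
have [p [pq ps pl]] := nodal_primitive (fun i => x 0 (r i)).
set q := \prod_i _ in pq.
have qr i : q.[x 0 (r i)] = 0.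
  by rewrite /q horner_prod (bigD1 i) //= !hornerE subrr mul0r.
have qa : q.[x 0 a] != 0.
  rewrite /q horner_prod; apply/prodf_neq0 => i _.
  by rewrite !hornerE subr_eq0 eq_sym.
have [A A0 AP] := fin_norm_upper_bound alpha.
have K0 : (0 : R) < K.+1%:R by [].
pose mu := alpha a * `|q.[x 0 a]|.
have mu0 : 0 < mu by rewrite mulr_gt0 // normr_gt0.
(* The total error is then at most half of the main term [mu * tau]. *)
pose eta := mu / (2 * (K.+1%:R * A * C)).
have den0 : 0 < 2 * (K.+1%:R * A * C) by rewrite !mulr_gt0.
have eta0 : 0 < eta by rewrite divr_gt0.
have [e1 e10 e1P] : exists2 e, 0 < e & forall j u, `|u - x 0 j| <= e ->
    `|p.[u] - p.[x 0 j] - q.[x 0 j] * (u - x 0 j)| <= eta * `|u - x 0 j|.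
  apply: (@fin_radius _ 'I_K (fun j e => forall u, `|u - x 0 j| <= e -> _)).
    by move=> j d d' dd' h u ud; apply: h; apply: le_trans dd'.
  move=> j; have [d d0 dP] := poly_strict_deriv p (x 0 j) eta0.
  exists d => // u ud; rewrite -pq; apply: dP => //.
  by rewrite subrr normr0 ltW.
pose m := Num.min e1 e.
have m0 : 0 < m by rewrite lt_min e10.
pose tau := Num.min delta (m / C).
have tau0 : 0 < tau by rewrite lt_min delta0 divr_gt0.
pose t := tau * Num.sg (s * q.[x 0 a]).
have tn : `|t| = tau.
  by rewrite normrM normr_sg mulf_neq0 // mulr1 gtr0_norm.
have [|theta [th tha thd thx]] := curve t; first by rewrite tn ge_min lexx.
have thm j : `|theta 0 j - x 0 j| <= m.
  by apply: le_trans (thd j) _; rewrite tn mulrC -ler_pdivlMr // ge_min lexx orbT.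
have [the1 the] : (forall j, `|theta 0 j - x 0 j| <= e1) /\
   (forall j, `|theta 0 j - x 0 j| <= e).
  by split => j; apply: le_trans (thm j) _; rewrite !ge_min lexx ?orbT.
exists theta; split=> //.
have := psum_variety_horner th ps; rewrite pl => pE.
rewrite -(@pmulr_rgt0 _ n.+1%:R^-1) ?invr_gt0 // mulrCA -pE.
pose err j := p.[theta 0 j] - p.[x 0 j] - q.[x 0 j] * (theta 0 j - x 0 j).
have -> : \sum_(j < K) alpha j * (p.[theta 0 j] - p.[x 0 j]) =
    alpha a * (q.[x 0 a] * t) + \sum_(j < K) alpha j * err j.
  have -> : alpha a * (q.[x 0 a] * t) =
      \sum_(j < K) alpha j * (q.[x 0 j] * (theta 0 j - x 0 j)).
    rewrite (bigD1 a) //= tha [x 0 a + t]addrC addrK big1 ?addr0 // => j ja.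
    have [/codomP[i ->]|jr] := boolP (j \in codom r).
      by rewrite qr mul0r mulr0.
    by rewrite thx // subrr !mulr0.
  by rewrite -big_split; apply: eq_bigr => j _; rewrite /err /=; ring.
rewrite mulrDr.
have -> : s * (alpha a * (q.[x 0 a] * t)) = `|s| * (mu * tau).
  rewrite /t /mu.
  transitivity (alpha a * tau * (Num.sg (s * q.[x 0 a]) * (s * q.[x 0 a]))); first by ring.
  by rewrite -normrEsg normrM; ring.
have errle : `|\sum_(j < K) alpha j * err j| <= K%:R * A * (eta * (C * tau)).
  apply: le_trans (ler_norm_sum _ _ _) _.
  apply: (@le_trans _ _ (\sum_(j < K) A * (eta * (C * tau)))).
    apply: ler_sum => j _; rewrite normrM ler_pM // (le_trans (e1P _ _ _)) //.
    by rewrite ler_wpM2l ?(ltW eta0) // -tn thd.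
  by rewrite sumr_const card_ord -[X in X <= _]mulr_natl mulrA.
have : K%:R * A * (eta * (C * tau)) < mu * tau.
  apply: le_lt_trans (_ : K.+1%:R * A * (eta * (C * tau)) < _).
    have X0 : 0 <= A * (eta * (C * tau)).
      apply: mulr_ge0; first exact: ltW.
      by apply: mulr_ge0; [exact: ltW | apply: mulr_ge0; exact: ltW].
    by rewrite -(mulrA K%:R A) -(mulrA K.+1%:R A) ler_wpM2r // ler_nat.
  have -> : K.+1%:R * A * (eta * (C * tau)) = mu * tau / 2.
    by rewrite /eta; field; rewrite !gt_eqF.
  by have := mulr_gt0 mu0 tau0; lra.
move=> h; rewrite -[X in _ + X]opprK subr_gt0.
apply: le_lt_trans (ler_norm _) _; rewrite normrN normrM ltr_pM2l ?normr_gt0 //.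
exact: le_lt_trans h.
Qed.

(** * Lebesgue null sets *)

(** The [i]-th set gets a cover of volume at most [e / 2 ^ i.+1], and a bijection of [nat] with
    [nat * nat] lists all the boxes in one sequence. *)
Lemma lebesgue_null_bigcup (R : realType) (K : nat) (N : nat -> set 'rV[R]_K) :
  (forall i, lebesgue_null (N i)) -> lebesgue_null (\bigcup_i N i).
Proof.
move=> N0 e e0.
pose vol (a b : 'rV[R]_K) := \prod_(j < K) (b 0 j - a 0 j).
have [ab abP] : {ab : nat -> (nat -> 'rV[R]_K) * (nat -> 'rV[R]_K) & forall i,
    [/\ forall k j, (ab i).1 k 0 j <= (ab i).2 k 0 j,
     N i `<=` \bigcup_k [set x | forall j, (ab i).1 k 0 j <= x 0 j <= (ab i).2 k 0 j]
   & (\sum_(0 <= k <oo) (vol ((ab i).1 k) ((ab i).2 k))%:E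
      <= (e / (2 ^ i.+1)%:R)%:E)%E]}.
  apply: (@boolp.choice _ _ (fun i (ab : (nat -> 'rV[R]_K) * (nat -> 'rV[R]_K)) =>
    [/\ forall k j, ab.1 k 0 j <= ab.2 k 0 j,
     N i `<=` \bigcup_k [set x | forall j, ab.1 k 0 j <= x 0 j <= ab.2 k 0 j]
   & (\sum_(0 <= k <oo) (vol (ab.1 k) (ab.2 k))%:E
      <= (e / (2 ^ i.+1)%:R)%:E)%E])) => i.
  have [|a [b [ab cov sum_ab]]] := N0 i (e / (2 ^ i.+1)%:R).
    by rewrite divr_gt0 // ltr0n expn_gt0.
  by exists (a, b).
have /card_esym/ppcard_eqP[f] := card_nat2.
exists (fun k => (ab (f k).1).1 (f k).2), (fun k => (ab (f k).1).2 (f k).2); split.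
- by move=> k j; have [] := abP (f k).1.
- move=> x [i _ Nx]; have [_ /(_ x Nx)[k _ xk] _] := abP i.
  by exists (f^-1%FUN (i, k)) => //=; rewrite invK ?inE.
pose g (p : nat * nat) := (vol ((ab p.1).1 p.2) ((ab p.1).2 p.2))%:E.
have g0 p : (0 <= g p)%E.
  rewrite lee_fin; apply: prodr_ge0 => j _; rewrite subr_ge0.
  by have [] := abP p.1.
rewrite -/(vol _ _) (eq_eseriesr (g := fun k => g (f k))) //.
rewrite nneseries_esumT; last by move=> k; apply: g0.
rewrite -(reindex_esum setT setT f g); last exact: bij.
rewrite (_ : setT = setT `*`` (fun=> setT)); last by apply/seteqP; split.
rewrite (eq_esum (b := fun p => g (p.1, p.2))); last by case.
rewrite -(esum_esum (a := fun i j => g (i, j))) //.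
apply: (@le_trans _ _ (\sum_(0 <= i <oo) (e / (2 ^ i.+1)%:R)%:E)%E).
  rewrite nneseries_esumT => [|i]; last first.
    by rewrite lee_fin divr_ge0 // ltW.
  apply: le_esum => i _; rewrite -nneseries_esumT //.
  by have [] := abP i.
exact: (epsilon_trick0 xpredT (ltW e0)).
Qed.

Lemma lebesgue_null_sub (R : realType) (K : nat) (A B : set 'rV[R]_K) :
  A `<=` B -> lebesgue_null B -> lebesgue_null A.
Proof.
move=> AB B0 e e0; have [a [b [ab cov sum_ab]]] := B0 e e0.
by exists a, b; split=> //; apply: subset_trans AB cov.
Qed.

(** The finite cover is continued by boxes reduced to the origin; they have volume 0 because the
    dimension is positive. *)
Lemma lebesgue_null_fin_cover (R : realType) (K : nat) (A : set 'rV[R]_K.+1) :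
  (forall e : R, 0 < e -> exists (I : finType) (a b : I -> 'rV[R]_K.+1),
    [/\ forall i j, a i 0 j <= b i 0 j,
        A `<=` [set x | exists i, forall j, a i 0 j <= x 0 j <= b i 0 j]
      & \sum_i \prod_(j < K.+1) (b i 0 j - a i 0 j) <= e]) ->
  lebesgue_null A.
Proof.
move=> h e e0; have [I [a [b [ab cov sum_ab]]]] := h e e0.
pose ext (c : I -> 'rV[R]_K.+1) k :=
  if insub k is Some i then c (enum_val (i : 'I_#|I|)) else 0.
exists (ext a), (ext b); split.
- by move=> k j; rewrite /ext; case: insubP.
- move=> x /cov[i xi]; exists (enum_rank i) => // j.
  by rewrite /ext valK enum_rankK.
pose v k := \prod_(j < K.+1) (ext b k 0 j - ext a k 0 j).
have v0 k : 0 <= v k.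
  apply: prodr_ge0 => j _; rewrite subr_ge0 /ext; case: insubP => //.
rewrite -/(v _) (@nneseries_split _ (fun k => (v k)%:E) 0 #|I|); last first.
  by move=> k _; rewrite lee_fin.
rewrite add0n eseries0 ?adde0 => [|k Ik _]; last first.
  rewrite /v; congr (_%:E); rewrite big_ord_recl /ext insubN ?subrr ?mul0r //.
  by rewrite -leqNgt.
rewrite sumEFin lee_fin; apply: le_trans sum_ab.
rewrite big_mkord [leRHS](reindex_onto enum_val enum_rank) => [|i _]; last exact: enum_rankK.
rewrite le_eqVlt; apply/orP; left; apply/eqP; apply: eq_big => [k|k _].
  by rewrite enum_valK eqxx.
by rewrite /v /ext; apply: eq_bigr => j _; rewrite valK.
Qed.

Lemma lebesgue_null_countable (R : realType) (K : nat) (I : countType)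
    (A : I -> set 'rV[R]_K.+1) :
  (forall i, lebesgue_null (A i)) -> lebesgue_null (\bigcup_i A i).
Proof.
move=> A0; pose N k : set 'rV[R]_K.+1 := if unpickle k is Some i then A i else set0.
apply: (@lebesgue_null_sub _ _ _ (\bigcup_k N k)).
  by move=> x [i _ Ax]; exists (pickle i) => //; rewrite /N pickleK.
apply: lebesgue_null_bigcup => k; rewrite /N; case: unpickle => [i //|].
apply: lebesgue_null_fin_cover => e e0; exists void, (fun=> 0), (fun=> 0).
by split=> //; rewrite big1 ?ltW // => -[].
Qed.

Lemma grid_cell (R : realDomainType) (N : nat) (s u : R) :
  (0 < N)%N -> 0 <= u -> u <= N%:R * s ->
  exists c : 'I_N, c%:R * s <= u <= c%:R * s + s.
Proof.
case: N => // N _ u0; elim: N => [|N IHN] uN.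
  by exists ord0; rewrite mul0r add0r u0 -[s]mul1r.
have [le|lt] := leP u (N.+1%:R * s).
  by have [c cP] := IHN le; exists (widen_ord (leqnSn _) c).
exists ord_max; rewrite (ltW lt) /=; apply: le_trans uN _.
by rewrite -[N.+2%:R]natr1 mulrDl mul1r.
Qed.

(* A Lipschitz graph over N^K cells of side 2M/N is covered by N^K boxes of
   total volume O(1/N). *)
Lemma lipschitz_graph_null (R : realType) (K : nat) (j0 : 'I_K.+1)
    (A : set 'rV[R]_K.+1) (C M : R) : 0 < C -> 0 < M ->
  (forall x, A x -> forall j, `|x 0 j| <= M) ->
  (forall x y, A x -> A y -> forall D, 0 <= D ->
    (forall j, j != j0 -> `|x 0 j - y 0 j| <= D) -> `|x 0 j0 - y 0 j0| <= C * D) ->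
  lebesgue_null A.
Proof.
move=> C0 M0 AM AC; apply: lebesgue_null_fin_cover => e e0.
(* There are [N ^ K] boxes of volume [2 * C * s ^+ K.+1] with [s = 2 * M / N], for a total of
   [Z / N]. *)
pose Z := 2 * C * (2 * M) ^+ K.+1.
have Z0 : 0 < Z by rewrite !mulr_gt0 // exprn_gt0 // mulr_gt0.
pose N := (Num.truncn (Z / e)).+1.
have NP : Z / N%:R <= e.
  rewrite ler_pdivrMr // mulrC -ler_pdivrMr //.
  by apply: ltW; rewrite /N truncnS_gt.
pose s := 2 * M / N%:R.
have s0 : 0 < s by rewrite divr_gt0 // mulr_gt0.
pose lo (c : 'I_N) := - M + c%:R * s.
pose cell (c : {ffun 'I_K -> 'I_N}) (x : 'rV[R]_K.+1) :=
  forall i, lo (c i) <= x 0 (lift j0 i) <= lo (c i) + s.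
(* The height [t c] is taken at some point of [A] in the cell [c], and is 0 when there is none. *)
have [t tP] : {t : {ffun 'I_K -> 'I_N} -> R & forall c x, A x -> cell c x ->
    `|x 0 j0 - t c| <= C * s}.
  apply: (@boolp.choice _ _ (fun c t => forall x, A x -> cell c x -> `|x 0 j0 - t| <= C * s)) => c.
  have [[y [Ay cy]]|no] := pselect (exists y, A y /\ cell c y); last first.
    by exists 0 => x Ax cx; case: no; exists x.
  exists (y 0 j0) => x Ax cx; apply: AC => //; first exact: ltW.
  move=> j; case: (unliftP j0 j) => [i ->|->]; last by rewrite eqxx.
  move=> _; have /andP[? ?] := cx i; have /andP[? ?] := cy i.
  by rewrite ler_norml; apply/andP; split; lra.
exists {ffun 'I_K -> 'I_N}.
exists (fun c : {ffun 'I_K -> 'I_N} => \row_j (if unlift j0 j is Some i then lo (c i) else t c - C * s)).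
exists (fun c : {ffun 'I_K -> 'I_N} => \row_j (if unlift j0 j is Some i then lo (c i) + s else t c + C * s)).
have Cs : 0 < C * s by rewrite mulr_gt0.
split.
- by move=> c j; rewrite !mxE; case: unlift => [i|]; lra.
- move=> x Ax.
  have [c cP] : {c : 'I_K -> 'I_N & forall i, lo (c i) <= x 0 (lift j0 i) <= lo (c i) + s}.
    apply: (@boolp.choice _ _ (fun i c => lo c <= x 0 (lift j0 i) <= lo c + s)) => i.
    have := AM x Ax (lift j0 i); rewrite ler_norml => /andP[? ?].
    have [//|||c /andP[? ?]] := @grid_cell _ N s (x 0 (lift j0 i) + M).
    - by lra.
    - by rewrite /s mulrC divfK ?pnatr_eq0 //; lra.
    by exists c; rewrite /lo; apply/andP; split; lra.
  exists [ffun i => c i] => j; rewrite !mxE; case: unliftP => [i ->|->].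
    by rewrite ffunE.
  rewrite -ler_distl; apply: tP => // i.
  by rewrite ffunE.
apply: le_trans NP; rewrite (eq_bigr (fun=> 2 * C * s ^+ K.+1)); last first.
  move=> c _; rewrite (bigD1_ord j0) //= !mxE unlift_none exprS.
  rewrite (eq_bigr (fun=> s)) => [|i _]; last by rewrite !mxE liftK; ring.
  by rewrite prodr_const card_ord; ring.
rewrite sumr_const card_ffun !card_ord -[X in X <= _]mulr_natr natrX.
rewrite /Z /s expr_div_n exprS [N%:R ^+ K.+1]exprS.
rewrite le_eqVlt; apply/orP; left; apply/eqP; field.
by rewrite expf_neq0 // pnatr_eq0.
Qed.

(** * Generic parameters *)

Definition distinct_coords (R : realType) (K : nat) (x : 'rV[R]_K) : seq R :=
  undup (codom (x 0)).

Lemma distinct_coordsE (R : realType) (K : nat) (x : 'rV[R]_K) (v : R) :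
  (v \in distinct_coords x) = (v \in codom (x 0)).
Proof. by rewrite mem_undup. Qed.

(** Under a fixed pattern, the coordinates of a block move together, so a block sum is one
    displacement times a positive weight. *)
Definition same_pattern (R : realType) (K : nat) (x x' : 'rV[R]_K) : Prop :=
  forall j k, (x' 0 j == x' 0 k) = (x 0 j == x 0 k).

(** Agreement of two points becomes the vanishing of a single power sum with signed weights, to
    which [block_estimate] applies. *)
Lemma psum_row_mx (R : realType) (K : nat) (alpha : 'I_K -> R)
    (x theta : 'rV[R]_K) (l : nat) :
  psum (fun i : 'I_(K + K) => match fintype.split i with inl j => alpha j | inr j => - alpha j end) l
    (row_mx x theta) = psum alpha l x - psum alpha l theta.
Proof.
rewrite /psum big_split_ord /= -sumrN; congr (_ + _); apply: eq_bigr => j _.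
  by rewrite (unsplitK (inl j : 'I_K + 'I_K)) row_mxEl.
by rewrite (unsplitK (inr j : 'I_K + 'I_K)) row_mxEr mulNr.
Qed.

(* The m distinct values of x together with theta_j0 are m + 1 nodes, as many as
   there are constraints, so they are controlled by the other coordinates of theta. *)
Lemma agreeing_pairs_lipschitz (R : realType) (K : nat) (alpha : 'I_K -> R)
    (x0 theta0 : 'rV[R]_K) (j0 : 'I_K) :
  (forall j, 0 < alpha j) -> theta0 0 j0 \notin codom (x0 0) ->
  let m := size (distinct_coords x0) in
  exists C e, [/\ 0 < C, 0 < e & forall x theta x' theta' : 'rV[R]_K,
    [/\ same_pattern x0 x, same_pattern x0 x',
        psum_variety alpha theta m.+1 x & psum_variety alpha theta' m.+1 x'] ->
    [/\ forall j, `|x 0 j - x0 0 j| <= e, forall j, `|theta 0 j - theta0 0 j| <= e,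
        forall j, `|x' 0 j - x0 0 j| <= e & forall j, `|theta' 0 j - theta0 0 j| <= e] ->
    forall D, 0 <= D -> (forall j, j != j0 -> `|theta 0 j - theta' 0 j| <= D) ->
    `|theta 0 j0 - theta' 0 j0| <= C * D].
Proof.
move=> alpha0 th0 m; pose nodes := theta0 0 j0 :: distinct_coords x0.
have nodes_uniq : uniq nodes by rewrite /= undup_uniq distinct_coordsE th0.
pose w (i : 'I_m.+1) := nth 0 nodes i.
have w_inj : injective w.
  by move=> i k /eqP; rewrite nth_uniq //= => /eqP/ord_inj.
have mem_w v : v \in nodes -> exists k, v = w k.
  move=> vn; have h : (index v nodes < m.+1)%N by rewrite index_mem.
  by exists (Ordinal h); rewrite /w /= nth_index.
have xw j : exists k, x0 0 j = w k.
  by apply: mem_w; rewrite in_cons distinct_coordsE codom_f orbT.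
have [k0 tw] : exists k, theta0 0 j0 = w k by apply: mem_w; rewrite mem_head.
pose a (i : 'I_(K + K)) := match fintype.split i with inl j => alpha j | inr j => - alpha j end.
have al j : a (lshift K j) = alpha j by rewrite /a (unsplitK (inl j : 'I_K + 'I_K)).
have ar j : a (rshift K j) = - alpha j by rewrite /a (unsplitK (inr j : 'I_K + 'I_K)).
have [C0 C00 blk] := block_estimate a (row_mx x0 theta0) w_inj.
have [b b0 bP] := fin_pos_lower_bound alpha0.
have [A A0 AP] := fin_norm_upper_bound alpha.
(* The [K.+1] displacements at nodes, those of [x] and of [theta 0 j0], then contribute at most
   [b / 2] times their maximum [X], which the left-hand side [b * X] absorbs. *)
pose eta := b / (2 * K.+1%:R).
have K0 : (0 : R) < K.+1%:R by [].
have eta0 : 0 < eta by rewrite divr_gt0 // mulr_gt0.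
pose G := (eta + C0 + A) * K%:R.
have G0 : 0 <= G by rewrite mulr_ge0 // !addr_ge0 // ltW.
have Gb0 : 0 <= 2 * G / b by apply: divr_ge0; [apply: mulr_ge0 | exact: ltW].
have [e e0 eP] := blk eta eta0.
exists (2 * G / b + 1), e; split=> //; first by rewrite ltr_wpDl.
move=> x theta x' theta' [px px' Vx Vx'] [xe the xe' the'] D D0 leD.
have ze j : `|row_mx x theta 0 j - row_mx x0 theta0 0 j| <= e.
  by rewrite !mxE; case: fintype.split.
have ze' j : `|row_mx x' theta' 0 j - row_mx x0 theta0 0 j| <= e.
  by rewrite !mxE; case: fintype.split.
have zz' : psum_variety a (row_mx x' theta') m.+1 (row_mx x theta).
  by move=> l lm; rewrite !psum_row_mx Vx // Vx' // !subrr.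
have main k := eP _ _ ze ze' zz' k.
have others (P : pred 'I_K) : ~~ P j0 ->
    `|\sum_(j < K | P j) - alpha j * (theta 0 j - theta' 0 j)| <= A * K%:R * D.
  move=> Pj0; apply: le_trans (ler_norm_sum _ _ _) _.
  apply: le_trans (_ : \sum_(j < K | P j) A * D <= _).
    apply: ler_sum => j Pj; rewrite normrM normrN ler_pM // leD //.
    by apply: contraNneq Pj0 => <-.
  rewrite sumr_const -[X in X <= _]mulr_natr mulrAC ler_wpM2r // ler_wpM2l ?(ltW A0) //.
  by rewrite ler_nat -[X in (_ <= X)%N](card_ord K) max_card.
pose T := `|theta 0 j0 - theta' 0 j0|.
have [X XP] : exists X, T <= X /\ (forall j, `|x 0 j - x' 0 j| <= X) /\
    (X = T \/ exists j, X = `|x 0 j - x' 0 j|).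
  pose f (o : option 'I_K) := if o is Some j then `|x 0 j - x' 0 j| else T.
  have [c _ cP] := @arg_maxP _ R (option 'I_K) None predT f isT.
  exists (f c); split; first exact: (cP None).
  split; first by move=> j; apply: (cP (Some j)).
  by case: c {cP} => [j|]; [right; exists j | left].
case: XP => TX [xX Xcase].
have X0 : 0 <= X by apply: le_trans TX; apply: normr_ge0.
have rhs : \sum_(i < K + K) (eta + C0 * (row_mx x0 theta0 0 i \notin codom w)%:R) *
    `|row_mx x theta 0 i - row_mx x' theta' 0 i| <= eta * K.+1%:R * X + (eta + C0) * K%:R * D.
  rewrite big_split_ord /=.
  apply: le_trans (_ : \sum_(i < K) eta * X + (eta * X + \sum_(i < K | i != j0) (eta + C0) * D) <= _).
    apply: lerD.
      apply: ler_sum => j _; rewrite !row_mxEl.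
      have -> : x0 0 j \in codom w by have [k ->] := xw j; apply: codom_f.
      by rewrite mulr0 addr0 ler_wpM2l // ltW.
    rewrite (bigD1 j0) //=; apply: lerD.
      rewrite !row_mxEr tw codom_f mulr0 addr0 ler_wpM2l //.
      exact: ltW.
    apply: ler_sum => j jj0; rewrite !row_mxEr; apply: ler_pM => //.
    - by rewrite addr_ge0 ?(ltW eta0) // mulr_ge0.
    - by rewrite lerD2l ler_piMr // lern1 leq_b1.
    - exact: leD.
  rewrite sumr_const card_ord addrA -mulrSr -[X in X + _ <= _]mulr_natr mulrAC.
  rewrite lerD2l sumr_const -[X in X <= _]mulr_natr mulrAC.
  rewrite ler_wpM2r // ler_wpM2l ?addr_ge0 ?(ltW eta0) //.
  by rewrite ler_nat -[X in (_ <= X)%N](card_ord K) max_card.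
(* No coordinate [j0] of [theta] enters this block, since [theta0 0 j0] is not a value of [x0]; the
   coordinates of [theta] that do enter are controlled by [D]. *)
have keyx j : b * `|x 0 j - x' 0 j| <= eta * K.+1%:R * X + G * D.
  have [k xk] := xw j; have := main k; rewrite big_split_ord /=.
  have notj0 : ~~ (theta0 0 j0 == w k).
    by apply: contraNN th0 => /eqP ->; rewrite -xk codom_f.
  rewrite (eq_bigl (fun i => x0 0 i == w k)) => [|i]; last by rewrite row_mxEl.
  rewrite (eq_bigr (fun i => alpha i * (x 0 j - x' 0 j))); last first.
    move=> i xi; rewrite al !row_mxEl; congr (_ * (_ - _)); apply/eqP.
      by rewrite px xk.
    by rewrite px' xk.
  rewrite -mulr_suml.
  rewrite [X in _ + X](eq_bigl (fun i => theta0 0 i == w k)) => [|i]; last by rewrite row_mxEr.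
  rewrite [X in _ + X](eq_bigr (fun i => - alpha i * (theta 0 i - theta' 0 i))); last first.
    by move=> i _; rewrite ar !row_mxEr.
  have := others (fun i => theta0 0 i == w k) notj0.
  set S2 := \sum_(_ < _ | _) _; set S1 := \sum_(_ < _ | _) _ => hS2 hm.
  have hS1 : b <= S1.
    rewrite /S1 (bigD1 j) ?xk //=; apply: le_trans (bP j) _.
    by rewrite lerDl sumr_ge0 // => i _; apply: ltW.
  apply: le_trans (_ : `|S1 * (x 0 j - x' 0 j)| <= _).
    by rewrite normrM ler_wpM2r // (le_trans hS1) // ler_norm.
  rewrite -[S1 * _](addrK S2); apply: le_trans (ler_normB _ _) _.
  have := le_trans hm rhs; rewrite /G; lra.
have keyt : b * T <= eta * K.+1%:R * X + G * D.
  have := main k0; rewrite big_split_ord /=.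
  rewrite big_pred0 => [|i]; last first.
    by rewrite row_mxEl -tw; apply: contraNF th0 => /eqP <-; apply: codom_f.
  rewrite add0r (bigD1 j0) ?row_mxEr ?tw //= ar.
  rewrite [X in _ + X](eq_bigl (fun i => (theta0 0 i == w k0) && (i != j0))) => [|i]; last by rewrite row_mxEr.
  rewrite [X in _ + X](eq_bigr (fun i => - alpha i * (theta 0 i - theta' 0 i))); last first.
    by move=> i _; rewrite ar !row_mxEr.
  have := others (fun i => (theta0 0 i == w k0) && (i != j0)).
  rewrite /= eqxx andbF => /(_ isT).
  set S2 := \sum_(_ < _ | _) _ => hS2; rewrite ?row_mxEr => hm.
  apply: le_trans (_ : `|- alpha j0 * (theta 0 j0 - theta' 0 j0)| <= _).
    rewrite normrM normrN (gtr0_norm (alpha0 j0)).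
    by apply: ler_wpM2r => //; apply: normr_ge0.
  rewrite -[- alpha j0 * _](addrK S2); apply: le_trans (ler_normB _ _) _.
  have := le_trans hm rhs; rewrite /G; lra.
have keyX : b * X <= eta * K.+1%:R * X + G * D 
  by case: Xcase => [XT|[j Xj]]; [move: keyt; rewrite -XT | rewrite {1}Xj].
apply: (le_trans TX).
have key : b / 2 * X <= G * D.
  have E : eta * K.+1%:R = b / 2 by rewrite /eta; field; rewrite gt_eqF.
  by move: keyX; rewrite E; lra.
have b20 : 0 < b / 2 by rewrite divr_gt0.
rewrite -(ler_pM2l b20); apply: le_trans key _.
have -> : b / 2 * ((2 * G / b + 1) * D) = G * D + b / 2 * D by field; rewrite gt_eqF.
by rewrite lerDl mulr_ge0 // ltW.
Qed.

(** The power [l] is interpolated on the values of [x] by a polynomial of degree less than their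
    number. It represents the power at the coordinates of both points, and the constraints equate
    its two sums. *)
Lemma psum_interpolation (R : realType) (K : nat) (alpha : 'I_K -> R)
    (x theta : 'rV[R]_K) :
  (forall j, theta 0 j \in codom (x 0)) ->
  psum_variety alpha theta (size (distinct_coords x)) x ->
  forall l, psum alpha l x = psum alpha l theta.
Proof.
move=> thx Vx l; set m := size _ in Vx.
pose w (i : 'I_m) := nth 0 (distinct_coords x) i.
have w_inj : injective w.
  by move=> i k /eqP; rewrite nth_uniq ?undup_uniq // => /eqP/ord_inj.
have xw v : v \in codom (x 0) -> exists k, v = w k.
  rewrite -distinct_coordsE => vx.
  have h : (index v (distinct_coords x) < m)%N by rewrite index_mem.
  by exists (Ordinal h); rewrite /w /= nth_index.
have [p ps pw] := lagrange_primitive w_inj.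
pose g := \sum_(i < m) w i ^+ l *: (p i)^`().
have gs : (size g <= m)%N.
  apply: leq_trans (size_sum _ _ _) _; apply/bigmax_leqP => i _.
  apply: leq_trans (size_scale_leq _ _) _.
  by apply: leq_trans (size_poly _ _) _; rewrite -subn1 leq_subLR add1n.
have gE v : v \in codom (x 0) -> g.[v] = v ^+ l.
  move=> /xw[k ->]; rewrite /g horner_sum (bigD1 k) //= hornerZ pw eqxx mulr1.
  by rewrite big1 ?addr0 // => i ik; rewrite hornerZ pw (negPf ik) mulr0.
have xE : psum alpha l x = \sum_(j < K) alpha j * g.[x 0 j].
  by apply: eq_bigr => j _; rewrite gE // codom_f.
have thE : psum alpha l theta = \sum_(j < K) alpha j * g.[theta 0 j].
  by apply: eq_bigr => j _; rewrite gE.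
rewrite xE thE !(psum_horner _ _ gs); apply: eq_bigr => -[[|k] km] _ /=.
  by rewrite !psum0.
by rewrite Vx //= ltnW.
Qed.

Lemma rat_approx (R : realType) (K : nat) (x : 'rV[R]_K) (d : R) : 0 < d ->
  exists c : 'rV[rat]_K, forall j, `|x 0 j - ratr (c 0 j)| <= d.
Proof.
move=> d0.
have [c cP] : {c : 'I_K -> rat & forall j, `|x 0 j - ratr (c j)| <= d}.
  apply: (@boolp.choice _ _ (fun j c => `|x 0 j - ratr c| <= d)) => j.
  have [c] := @rat_in_itvoo R (x 0 j - d) (x 0 j + d) ltac:(lra).
  rewrite in_itv /= => /andP[? ?]; exists c.
  by rewrite ler_norml; apply/andP; split; lra.
by exists (\row_j c j) => j; rewrite mxE.
Qed.

(** The local Lipschitz property depends on an arbitrary pair of points; a pattern, rational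
    centres, a radius [1 / k.+1] and an integer Lipschitz constant make the exceptional sets
    countably many. *)
Lemma generic_distinct_coords (R : realType) (K : nat) (alpha : 'I_K.+1 -> R) :
  (forall j, 0 < alpha j) ->
  generic (fun theta : 'rV[R]_K.+1 => forall x : 'rV[R]_K.+1,
    psum_variety alpha theta (size (distinct_coords x)).+1 x ->
    forall l, psum alpha l x = psum alpha l theta).
Proof.
move=> alpha0.
pose idx := ({ffun 'I_K.+1 * 'I_K.+1 -> bool} * 'I_K.+1 * nat *
  ('rV[rat]_K.+1 * 'rV[rat]_K.+1) * (nat * nat))%type.
pose S (pat : {ffun 'I_K.+1 * 'I_K.+1 -> bool}) (m : nat) (c d : 'rV[rat]_K.+1)
    (k : nat) (theta : 'rV[R]_K.+1) := exists x : 'rV[R]_K.+1,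
  [/\ forall i j, (x 0 i == x 0 j) = pat (i, j), psum_variety alpha theta m.+1 x,
     forall j, `|x 0 j - ratr (c 0 j)| <= k.+1%:R^-1
   & forall j, `|theta 0 j - ratr (d 0 j)| <= k.+1%:R^-1].
pose lip (j0 : 'I_K.+1) (l : nat) (B : set 'rV[R]_K.+1) := forall x y, B x -> B y ->
  forall D, 0 <= D -> (forall j, j != j0 -> `|x 0 j - y 0 j| <= D) ->
    `|x 0 j0 - y 0 j0| <= l.+1%:R * D.
pose A (i : idx) := let: (pat, j0, m, (c, d), (k, l)) := i in
  [set theta | S pat m c d k theta /\ lip j0 l (S pat m c d k)].
exists (\bigcup_i A i).
  apply: lebesgue_null_countable => -[[[[pat j0] m] [c d]] [k l]].
  have [M M0 MP] := fin_norm_upper_bound (fun j => ratr (d 0 j) : R).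
  apply: (@lipschitz_graph_null R K j0 _ l.+1%:R (M + 1)) => //.
  - by rewrite addr_gt0.
  - move=> theta [[x [_ _ _ thd]] _] j.
    rewrite -[theta 0 j](subrK (ratr (d 0 j))) addrC.
    apply: le_trans (ler_normD _ _) _; apply: lerD => //.
    by apply: le_trans (thd j) _; rewrite invf_le1 // ler1n.
  - by move=> x y [Sx Slip] [Sy _]; apply: Slip.
move=> theta thA x Vx.
have [thx|[j0 thj0]] : (forall j, theta 0 j \in codom (x 0)) \/
    exists j, theta 0 j \notin codom (x 0).
  have [h|/forallPn[j hj]] := boolP [forall j, theta 0 j \in codom (x 0)].
    by left; apply/forallP.
  by right; exists j.
  apply: psum_interpolation => // l /andP[l0 lm].
  by apply: Vx; rewrite l0 ltnW.
case: thA.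
have [C [e [C0 e0 CP]]] := agreeing_pairs_lipschitz alpha0 thj0.
set m := size _ in Vx CP.
(* Two points within [1 / k.+1] of the same rational centre are then within [e] of any such third
   point, in particular of [x] or [theta]. *)
pose k := Num.truncn (2 / e).
have ke : 2 * k.+1%:R^-1 <= e.
  rewrite ler_pdivrMr // mulrC -ler_pdivrMr //; apply: ltW; exact: truncnS_gt.
pose l := Num.truncn C.
have lC : C <= l.+1%:R by apply: ltW; apply: truncnS_gt.
have k0 : 0 < k.+1%:R^-1 :> R by rewrite invr_gt0.
have [c cP] := rat_approx x k0; have [d dP] := rat_approx theta k0.
exists ([ffun ij => x 0 ij.1 == x 0 ij.2], j0, m, (c, d), (k, l)) => //.
split; first by exists x; split=> // i j; rewrite ffunE.
have near (y z : 'rV[R]_K.+1) (q : 'rV[rat]_K.+1) :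
    (forall j, `|y 0 j - ratr (q 0 j)| <= k.+1%:R^-1) ->
    (forall j, `|z 0 j - ratr (q 0 j)| <= k.+1%:R^-1) ->
    forall j, `|y 0 j - z 0 j| <= e.
  move=> yq zq j; apply: le_trans ke; rewrite mulr_natl mulr2n.
  have -> : y 0 j - z 0 j = (y 0 j - ratr (q 0 j)) - (z 0 j - ratr (q 0 j)) by ring.
  by apply: le_trans (ler_normB _ _) _; apply: lerD.
move=> y z [u [up uV uc yd]] [v [vp vV vc zd]] D D0 yz.
apply: le_trans (_ : C * D <= _); last by rewrite ler_wpM2r.
apply: (CP u y v z) => //.
  by split=> // i j; rewrite ?up ?vp ffunE.
by split; [exact: near uc cP | exact: near yd dP | exact: near vc cP | exact: near zd dP].
Qed.

(** * Uniform weights: an interlacing polynomial *)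

(** The roots are nonincreasing, so those above [t] come first; their number [N] counts the negative
    factors. *)
Lemma prod_sign_threshold (R : realDomainType) (n : nat) (z : nat -> R) (t : R) :
  (forall k, (k.+1 < n)%N -> z k.+1 <= z k) ->
  exists N, [/\ (N <= n)%N, forall k, (k < N)%N -> t < z k,
    forall k, (N <= k < n)%N -> z k <= t
  & 0 <= (-1) ^+ N * \prod_(k < n) (t - z k)].
Proof.
elim: n => [|n IHn] zd.
  by exists 0%N; rewrite big_ord0 mulr1; split=> // k; rewrite andbF.
have [|N [Nn Nlt Nge Nsgn]] := IHn; first by move=> k kn; apply/zd/ltnW.
have [lt|le] := ltP t (z n).
  have NE : N = n.
    apply/eqP; rewrite eqn_leq Nn leqNgt; apply/negP => ltN.
    have zle m : (N + m <= n)%N -> z (N + m)%N <= t.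
      elim: m => [|m IHm] h.
        by rewrite addn0; apply: Nge; rewrite leqnn ltN.
      by rewrite addnS in h *; apply: le_trans (zd _ h) (IHm (ltnW h)).
    by have := zle (n - N)%N; rewrite subnKC // leqnn leNgt lt => /(_ isT).
  rewrite NE in Nlt Nsgn; exists n.+1; split=> //.
  - by move=> k; rewrite ltnS leq_eqVlt => /predU1P[->|/Nlt].
  - by move=> k; rewrite leqNgt andNb.
  rewrite big_ord_recr /= exprS -mulrA mulN1r mulrA -mulrN.
  by rewrite mulr_ge0 // oppr_ge0 subr_le0 ltW.
exists N; split=> //; first exact: leqW.
- move=> k /andP[Nk]; rewrite ltnS leq_eqVlt => /predU1P[->//|kn].
  by rewrite Nge // Nk.
by rewrite big_ord_recr /= mulrA mulr_ge0 // subr_ge0.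
Qed.

(* The roots z_k of the derivative are the nodes y_k, except that at a simple
   node y_k, attained by X only at j_k, the root is T_(j_k) clamped between the
   neighbouring nodes.  The derivative then has constant sign between X_j and
   T_j, for every j. *)
Lemma interlacing_primitive (R : rcfType) (K n : nat) (X T y : nat -> R)
    (b : bool) :
  (forall i j, (i <= j)%N -> (j < K)%N -> T j <= T i) ->
  (forall i j, (i <= j)%N -> (j < K)%N -> X j <= X i) ->
  (forall i k, (i < k)%N -> (k < n)%N -> y k < y i) ->
  (forall j, (j < K)%N -> exists2 i, (i < n)%N & X j = y i) ->
  (forall k, (k < n)%N -> odd k (+) b -> exists j,
    [/\ (j < K)%N, X j = y k & forall i, (i < K)%N -> X i = y k -> i = j]) ->
  exists p : {poly R}, [/\ (size p <= n.+2)%N, p`_n.+1 = n.+1%:R^-1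
    & forall j, (j < K)%N -> 0 <= (-1) ^+ b * (p.[T j] - p.[X j])].
Proof.
move=> Tdec Xdec ydec Xy yX.
have [js jsP] : {js : nat -> nat & forall k, (k < n)%N -> odd k (+) b ->
    [/\ (js k < K)%N, X (js k) = y k & forall i, (i < K)%N -> X i = y k -> i = js k]}.
  apply: (@boolp.choice _ _ (fun k j => (k < n)%N -> odd k (+) b ->
    [/\ (j < K)%N, X j = y k & forall i, (i < K)%N -> X i = y k -> i = j])) => k.
  have [kn|] := boolP ((k < n)%N && (odd k (+) b)).
    by have /andP[k1 k2] := kn; have [j jP] := yX k k1 k2; exists j.
  by exists 0%N => k1 k2; rewrite k1 k2 in i.
(* Clamping from above by the preceding node, absent for [k = 0]; [z] then clamps from below by the
   following node, absent for the last one. *)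
pose u k := if k is k'.+1 then Num.min (T (js k)) (y k') else T (js k).
pose z k := if odd k (+) b then (if (k.+1 < n)%N then Num.max (u k) (y k.+1) else u k)
            else y k.
have uT k : u k <= T (js k) by case: k => [|k] //=; rewrite ge_min lexx.
have sS k : odd k.+1 (+) b = ~~ (odd k (+) b) by rewrite /= addNb.
have zd k : (k.+1 < n)%N -> z k.+1 <= z k.
  move=> kn; rewrite /z sS; case: (boolP (odd k (+) b)) => sk /=.
    by rewrite kn le_max lexx orbT.
  by case: ifP => h; rewrite ?ge_max ge_min lexx orbT //= ltW // ydec.
have y_inj i k : (i < n)%N -> (k < n)%N -> y k < y i -> (i < k)%N.
  move=> i_n k_n yy; rewrite ltnNge leq_eqVlt; apply/negP => /predU1P[E|h].
    by rewrite E ltxx in yy.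
  by have := lt_trans yy (ydec _ _ h i_n); rewrite ltxx.
(* A simple node is attained by [X] only at [js k], so the order of the nodes fixes the order of the
   indices, hence that of the values of [T]. *)
have Xjs i j k : (i < n)%N -> (j < K)%N -> X j = y i -> (k < n)%N -> odd k (+) b ->
    ((k <= i)%N -> T j <= T (js k)) /\ ((i <= k)%N -> T (js k) <= T j).
  move=> i_n jK Xj kn sk; have [jkK Xjk uniq] := jsP k kn sk.
  split; rewrite leq_eqVlt => /predU1P[E|h].
  - by rewrite -E in Xj; rewrite (uniq j jK) // Xj.
  - apply: Tdec => //; rewrite leqNgt; apply/negP => jj.
    have := Xdec _ _ (ltnW jj) jkK; rewrite Xj Xjk leNgt.
    by rewrite ydec.
  - by rewrite E in Xj; rewrite (uniq j jK).
  - apply: Tdec => //; rewrite leqNgt; apply/negP => jj.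
    have := Xdec _ _ (ltnW jj) jK; rewrite Xj Xjk leNgt.
    by rewrite ydec.
have [p [pq ps pl]] := @nodal_primitive R n (fun k => z k).
exists p; split=> // j jK; have [i i_n Xj] := Xy j jK.
have p'E t : p^`().[t] = \prod_(k < n) (t - z k).
  by rewrite pq horner_prod; apply: eq_bigr => k _; rewrite hornerXsubC.
have [lt|gt|->] := ltgtP (X j) (T j); last by rewrite subrr mulr0.
  have [t] := poly_mvt p lt; rewrite in_itv /= => /andP[Xt tT] ->.
  rewrite mulrA mulr_ge0 // ?subr_ge0 ?(ltW lt) // p'E.
  have [N [Nn Nlt Nge]] := prod_sign_threshold t zd.
  suff <- : odd N = b by rewrite signr_odd.
  (* With the other parity, position [N] is simple and its clamped root exceeds [t], whereas the
     roots from [N] on are at most [t]. *)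
  apply/eqP; rewrite -negb_add; apply/negP => sN.
  have yN k : N = k.+1 -> t < y k.
    move=> Nk; have := Nlt k; rewrite Nk ltnSn /z => /(_ isT).
    by move: sN; rewrite Nk /= addNb => /negPf ->.
  have Ni : (N <= i)%N.
    case: (N) Nn yN => // k kn /(_ k erefl) tk.
    by apply: y_inj => //; rewrite -Xj (lt_trans Xt).
  have Nltn := leq_ltn_trans Ni i_n.
  have [/(_ Ni) TT _] := Xjs i j N i_n jK Xj Nltn sN.
  have := Nge N; rewrite leqnn Nltn /z sN leNgt => /(_ isT)/negP; apply.
  have tu : t < u N.
    rewrite /u; case: (N) yN TT => [_|k yk] TT; first exact: lt_le_trans tT TT.
    by rewrite lt_min (lt_le_trans tT TT) yk.
  by case: ifP => _ //; rewrite lt_max tu.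
have [t] := poly_mvt p gt; rewrite in_itv /= => /andP[Tt tX] E.
rewrite -opprB E mulrN mulrA -mulNr mulr_ge0 // ?subr_ge0 ?(ltW gt) // p'E.
have [N [Nn Nlt Nge]] := prod_sign_threshold t zd.
have bE (c d : bool) : c (+) d -> d = ~~ c by case: c d => [] [].
suff /bE -> : odd N (+) b by rewrite signrN mulNr opprK signr_odd.
(* Symmetrically, the wrong parity makes the position before [N] simple, with a clamped root at most
   [t], whereas the roots before [N] exceed [t]. *)
apply/negPn/negP => sN.
have yN : (N < n)%N -> y N <= t.
  by move=> ltN; have := Nge N; rewrite leqnn ltN /z (negPf sN) => /(_ isT).
have iN : (i < N)%N.
  case: (ltnP N n) => [ltN|le]; last exact: leq_trans i_n le.
  by apply: y_inj => //; rewrite -Xj; apply: le_lt_trans tX; apply: yN.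
case: N Nn Nlt Nge sN yN iN => // N Nn Nlt _ sN yN iN.
rewrite sS negbK in sN.
have [_ /(_ iN) TT] := Xjs i j N i_n jK Xj Nn sN.
have tu : u N < t by apply: le_lt_trans (uT N) (le_lt_trans TT Tt).
have := Nlt N (ltnSn N); rewrite /z sN ltNge => /negP; apply.
by case: ifP => h; rewrite ?ge_max ltW //= yN.
Qed.

(** * Gradients and critical points *)

Lemma is_derive_coord (R : realType) (K : nat) (x v : 'rV[R]_K) (i : 'I_K) :
  is_derive x v (fun theta : 'rV[R]_K => theta 0 i) (v 0 i).
Proof.
have did : derivable (@id 'rV[R]_K) x v by apply: ex_derive.
apply: DeriveDef; first by have /derivable_mxP := did; apply.
have := @derive_id R 'rV[R]_K x v.
by rewrite derive_mx // => /rowP/(_ i); rewrite mxE.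
Qed.

Lemma is_derive_psum (R : realType) (K : nat) (alpha : 'I_K -> R) (l : nat)
    (x v : 'rV[R]_K) :
  is_derive x v (psum alpha l)
    (\sum_(j < K) alpha j * (l%:R * x 0 j ^+ l.-1 * v 0 j)).
Proof.
have -> : psum alpha l =
    \sum_(j < K) (alpha j \*: (fun theta : 'rV[R]_K => theta 0 j) ^+ l).
  by apply/funext => theta; rewrite fct_sumE; apply: eq_bigr => j _; rewrite exprfctE.
apply: is_derive_sum => j; apply: is_deriveZ.
have h := is_derive_coord x v j.
exact: (is_deriveX _ h).
Qed.

Lemma grad_psum (R : realType) (K : nat) (alpha : 'I_K -> R) (l : nat)
    (x : 'rV[R]_K) :
  grad (psum alpha l) x = \row_j (alpha j * (l%:R * x 0 j ^+ l.-1)).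
Proof.
apply/rowP => j; rewrite !mxE; have h := is_derive_psum alpha l x (delta_mx 0 j).
rewrite derive_val (bigD1 j) //= mxE !eqxx mulr1 big1 ?addr0 // => i ij.
by rewrite mxE eqxx (negPf ij) !mulr0.
Qed.

Lemma grad_psum_loss (R : realType) (K : nat) (alpha : 'I_K -> R) (l : nat)
    (theta x : 'rV[R]_K) :
  grad (psum_loss alpha theta l) x =
  (psum alpha l x - psum alpha l theta) *: grad (psum alpha l) x.
Proof.
apply/rowP => j; rewrite !mxE; have h := is_derive_psum alpha l x (delta_mx 0 j).
have -> : psum_loss alpha theta l =
    2^-1 \*: ((psum alpha l - cst (psum alpha l theta)) ^+ 2).
  by apply/funext => y; rewrite /psum_loss /= exprfctE.
have hB := is_deriveB h (is_derive_cst (psum alpha l theta) x (delta_mx 0 j)).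
have hZ := is_deriveZ 2^-1 (is_deriveX 2 hB).
rewrite (@derive_val _ _ _ _ _ _ _ hZ) (@derive_val _ _ _ _ _ _ _ h) subr0.
by rewrite /= expr1 -[_ *: _]/(_ * (2%:R * _ * _)) !mulrA mulVf ?mul1r.
Qed.

(** The gradient of p_l has entries [alpha j * l * x_j ^ (l - 1)], and the factor [l] is
    invertible. *)
Lemma span_grad_psum (R : realType) (K n : nat) (alpha : 'I_K -> R)
    (x v : 'rV[R]_K) :
  v \in <<[seq grad (psum alpha l) x | l <- iota 1 n]>>%VS <->
  exists2 c : {poly R}, (size c <= n)%N & forall j, v 0 j = alpha j * c.[x 0 j].
Proof.
elim: n v => [|n IHn] v.
  rewrite span_nil memv0; split=> [/eqP ->|[c]].
    by exists 0; rewrite ?size_poly0 // => j; rewrite mxE horner0 mulr0.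
  rewrite leqn0 size_poly_eq0 => /eqP -> h; apply/eqP/rowP => j.
  by rewrite h horner0 mulr0 mxE.
rewrite -(addn1 n) iotaD map_cat span_cat /= span_seq1 add1n addn1.
split=> [/memv_addP[u /IHn[c cn uE] [_ /vlineP[k ->] ->]]|[c cn vE]].
  exists (c + (k * n.+1%:R) *: 'X^n).
    apply: leq_trans (size_polyD _ _) _; rewrite geq_max (leqW cn) /=.
    by apply: leq_trans (size_scale_leq _ _) _; rewrite size_polyXn.
  move=> j; rewrite grad_psum !mxE uE hornerD hornerZ hornerXn /=.
  by ring.
pose u := v - (c`_n / n.+1%:R) *: grad (psum alpha n.+1) x.
apply/memv_addP; exists u.
  apply/IHn; exists (c - c`_n *: 'X^n).
    apply/leq_sizeP => i ni; rewrite coefB coefZ coefXn.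
    have [->|ni'] := eqVneq i n; first by rewrite mulr1 subrr.
    rewrite mulr0 subr0 nth_default //; apply: leq_trans cn _.
    by rewrite ltn_neqAle eq_sym ni'.
  move=> j; rewrite /u grad_psum !mxE vE hornerD hornerN hornerZ hornerXn /=.
  by field; rewrite addrC natr1 pnatr_eq0.
exists ((c`_n / n.+1%:R) *: grad (psum alpha n.+1) x); last by rewrite /u subrK.
by apply/vlineP; exists (c`_n / n.+1%:R).
Qed.

(** Criticality means that some monic polynomial of degree [n] vanishes at all coordinates of
    [x]. *)
Lemma critical_point_distinct_coords (R : realType) (K n : nat)
    (alpha : 'I_K -> R) (theta x : 'rV[R]_K) :
  (forall j, 0 < alpha j) ->
  critical_point alpha theta n (psum alpha n.+1) x <->
  psum_variety alpha theta n x /\ (size (distinct_coords x) <= n)%N.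
Proof.
move=> alpha0; rewrite /critical_point span_grad_psum.
split=> -[Vx]; last first.
  move=> dn; split=> //; pose s := distinct_coords x.
  (* The power of ['X] raises the degree to exactly [n] when there are fewer values. *)
  pose q := \prod_(v <- s) ('X - v%:P) * 'X^(n - size s).
  have qE : q = 'X^n + (q - 'X^n) by rewrite addrC subrK.
  have qm : q \is monic by rewrite monicMr ?monicXn // monic_prod_XsubC.
  have qs : size q = n.+1.
    rewrite size_monicM ?monic_prod_XsubC ?monic_neq0 ?monicXn //.
    by rewrite size_prod_XsubC size_polyXn addSn addnS /= subnKC.
  exists (- (n.+1%:R *: (q - 'X^n))).
    rewrite size_polyN; apply: leq_trans (size_scale_leq _ _) _.
    apply/leq_sizeP => i; rewrite leq_eqVlt => /predU1P[<-|ni].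
      move: qm; rewrite monicE lead_coefE qs /= => /eqP qn.
      by rewrite coefB coefXn eqxx qn subrr.
    by rewrite coefB coefXn gtn_eqF // subr0 nth_default // qs.
  move=> j; rewrite grad_psum mxE hornerN hornerZ hornerD hornerN hornerXn.
  have -> : q.[x 0 j] = 0.
    apply/rootP; rewrite /q rootM root_prod_XsubC.
    by rewrite -/(distinct_coords x) distinct_coordsE codom_f.
  by rewrite /=; ring.
case=> c cn cE; split=> //.
have q0 : 'X^n - n.+1%:R^-1 *: c != 0.
  apply/eqP => /(congr1 (fun p : {poly R} => p`_n)); rewrite coefB coefXn eqxx coefZ coef0.
  by rewrite nth_default // mulr0 subr0 => /eqP; rewrite oner_eq0.
rewrite -ltnS; apply: leq_trans (max_poly_roots q0 _ (undup_uniq _)) _.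
  apply/allP => v; rewrite -/(distinct_coords x) distinct_coordsE => /codomP[j ->].
  rewrite /root hornerD hornerN hornerZ hornerXn.
  have := cE j; rewrite grad_psum mxE /= => /(mulfI _) <-; last by rewrite gt_eqF.
  by rewrite mulrA mulVf ?pnatr_eq0 // mul1r subrr.
apply: leq_trans (size_polyD _ _) _; rewrite geq_max size_polyXn size_polyN.
by rewrite leqnn /=; apply: leq_trans (size_scale_leq _ _) (leqW cn).
Qed.

(** * Multiplicities *)

(** Positions count from 0: [b = false] concerns the entries m_i with [i] even, and [b = true] those
    with [i] odd. *)
Definition simple_blocks (R : realType) (K : nat) (b : bool) (x : 'rV[R]_K) : Prop :=
  forall k, (k < size (coord_values x))%N -> odd k (+) b ->
    count_mem (nth 0 (coord_values x) k) (codom (x 0)) = 1%N.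

Lemma size_coord_values (R : realType) (K : nat) (x : 'rV[R]_K) :
  size (coord_values x) = size (distinct_coords x).
Proof. by rewrite size_sort. Qed.

Lemma mem_coord_values (R : realType) (K : nat) (x : 'rV[R]_K) (v : R) :
  (v \in coord_values x) = (v \in codom (x 0)).
Proof. by rewrite mem_sort mem_undup. Qed.

Lemma nth_sort_ge (R : realDomainType) (s : seq R) (i j : nat) :
  (i <= j)%N -> (j < size s)%N -> nth 0 (sort >=%R s) j <= nth 0 (sort >=%R s) i.
Proof.
move=> ij js; have st : sorted >=%R (sort >=%R s).
  by apply: sort_sorted => u v; apply: le_total.
apply: (@sorted_leq_nth _ >=%R _ _ 0 _ st) => //.
- by move=> u v t uv vt; apply: le_trans vt uv.
- exact: lexx.
- by rewrite ?inE size_sort (leq_ltn_trans ij).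
- by rewrite ?inE size_sort.
Qed.

Lemma coord_values_lt (R : realType) (K : nat) (x : 'rV[R]_K) (i k : nat) :
  (i < k)%N -> (k < size (coord_values x))%N ->
  nth 0 (coord_values x) k < nth 0 (coord_values x) i.
Proof.
move=> ik ks; rewrite lt_neqAle; apply/andP; split; last first.
  by apply: nth_sort_ge; [exact: ltnW | rewrite size_sort in ks].
rewrite nth_uniq ?gtn_eqF //; first exact: ltn_trans ks.
by rewrite sort_uniq undup_uniq.
Qed.

Lemma nth_multiplicities (R : realType) (K : nat) (x : 'rV[R]_K) (k : nat) :
  (k < size (coord_values x))%N -> nth 0%N (multiplicities x) k =
    count_mem (nth 0 (coord_values x) k) (codom (x 0)).
Proof. by move=> ks; rewrite (nth_map 0). Qed.

Lemma even_entries_one_simple (R : realType) (K : nat) (x : 'rV[R]_K) :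
  even_entries_one (multiplicities x) <-> simple_blocks false x.
Proof.
rewrite /even_entries_one size_map; split=> h.
  move=> k ks; rewrite addbF => ok; rewrite -nth_multiplicities //.
  by apply: (h k.+1); rewrite //= ok.
move=> [|k] //= ks; rewrite negbK => ok; rewrite nth_multiplicities //.
by apply: h; rewrite ?addbF.
Qed.

Lemma odd_entries_one_simple (R : realType) (K : nat) (x : 'rV[R]_K) :
  odd_entries_one (multiplicities x) <-> simple_blocks true x.
Proof.
rewrite /odd_entries_one size_map; split=> h.
  move=> k ks; rewrite addbT => ok; rewrite -nth_multiplicities //.
  by apply: (h k.+1); rewrite //= ok.
move=> [|k] //= ks => ok; rewrite nth_multiplicities //.
by apply: h; rewrite ?addbT.
Qed.

Lemma count_codom (T : finType) (U : eqType) (f : T -> U) (v : U) :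
  count_mem v (codom f) = #|[pred j | f j == v]|.
Proof. by rewrite count_map cardE -size_filter enumT. Qed.

(** The derivative at [y i] is the product of the [y i - y k] for [k != i], of which exactly [i] are
    negative. *)
Lemma nodal_deriv_sign (R : realDomainType) (n : nat) (y : nat -> R) (i : 'I_n) :
  (forall i k, (i < k)%N -> (k < n)%N -> y k < y i) ->
  0 < (-1) ^+ i * (\prod_(k < n) ('X - (y k)%:P))^`().[y i].
Proof.
move=> ydec; rewrite (bigD1 i) //= derivM derivXsubC mul1r !hornerE subrr mul0r addr0.
rewrite horner_prod.
have -> : (-1) ^+ i = \prod_(k < n | k != i) (if (k < i)%N then -1 else 1) :> R.
  rewrite -[X in _ ^+ X]card_ord -prodr_const.
  rewrite (big_ord_widen n (fun=> -1)) ?(ltnW (ltn_ord i)) //.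
  rewrite big_mkcond /= [RHS]big_mkcond; apply: eq_bigr => k _.
  by have [->|ki] := eqVneq k i; rewrite ?ltnn.
rewrite -big_split /=; apply: prodr_gt0 => k ki.
rewrite hornerXsubC; case: ltnP => [lt|le].
  by rewrite mulN1r opprB subr_gt0 ydec.
by rewrite mul1r subr_gt0 ydec // ltn_neqAle eq_sym ki le.
Qed.

(** * Neighbourhoods in the variety and variation of the loss *)

Lemma near_within_rVP (R : realType) (K : nat) (A : set 'rV[R]_K)
    (P : 'rV[R]_K -> Prop) (x : 'rV[R]_K) :
  (\forall y \near within A (nbhs x), P y) <->
  exists2 e, 0 < e & forall y, A y -> (forall j, `|y 0 j - x 0 j| <= e) -> P y.
Proof.
split=> [/nbhs_normP[e /= e0 eP]|[e e0 eP]].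
  exists (e / 2) => [|y Ay ye]; first exact: divr_gt0.
  apply: eP => //=; rewrite distrC; apply: (@le_lt_trans _ _ (e / 2)).
    apply/rV_norm_leP => [|j]; first exact/ltW/divr_gt0.
    by rewrite !mxE.
  by rewrite ltr_pdivrMr // ltr_pMr // ltr1n.
suff : nbhs x (fun y => A y -> P y) by [].
apply/nbhs_ballP; exists e => //= y; rewrite -ball_normE /= distrC => ye Ay.
apply: eP => // j; have /rV_norm_leP := ltW ye => /(_ (ltW e0) j).
by rewrite !mxE.
Qed.

Lemma psum_continuous_at (R : realType) (K : nat) (alpha : 'I_K -> R) (l : nat)
    (x : 'rV[R]_K) (d : R) : 0 < d ->
  exists2 e, 0 < e & forall theta : 'rV[R]_K,
    (forall j, `|theta 0 j - x 0 j| <= e) -> `|psum alpha l theta - psum alpha l x| <= d.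
Proof.
move=> d0; have [A A0 AP] := fin_norm_upper_bound alpha.
pose eta := d / (A * K.+1%:R).
have eta0 : 0 < eta by rewrite divr_gt0 // mulr_gt0.
have [] := @fin_radius R 'I_K (fun j e => forall u, `|u - x 0 j| <= e ->
    `|u ^+ l - x 0 j ^+ l| <= eta).
- by move=> j a b ab h u ua; apply: h; apply: le_trans ab.
- move=> j; have [e e0 eP] := poly_cont (x 0 j) 'X^l eta0.
  exists (e / 2) => [|u ue]; first exact: divr_gt0.
  have := eP u; rewrite !hornerXn => h; apply/ltW/h.
  by apply: le_lt_trans ue _; rewrite ltr_pdivrMr // ltr_pMr // ltr1n.
move=> e e0 eP; exists e => // theta the.
rewrite /psum -sumrB; apply: le_trans (ler_norm_sum _ _ _) _.
apply: (@le_trans _ _ (\sum_(j < K) A * eta)).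
  by apply: ler_sum => j _; rewrite -mulrBr normrM ler_pM // eP.
rewrite sumr_const card_ord -[X in X <= _]mulr_natr.
have -> : A * eta * K%:R = d * (K%:R / K.+1%:R).
  by rewrite /eta; field; rewrite !gt_eqF.
by rewrite ler_piMr ?(ltW d0) // ler_pdivrMr // mul1r ler_nat.
Qed.

(** Here [df = dp * (2 * u + dp) / 2], and near [x] the bound of [dp] by [u] in absolute value gives
    [2 * u + dp] the sign of [u]. *)
Lemma psum_loss_monotone (R : realType) (K : nat) (alpha : 'I_K -> R) (l : nat)
    (theta_star x : 'rV[R]_K) :
  let u := psum alpha l x - psum alpha l theta_star in u != 0 ->
  exists2 e, 0 < e & forall theta : 'rV[R]_K, (forall j, `|theta 0 j - x 0 j| <= e) ->
    let dp := psum alpha l theta - psum alpha l x in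
    let df := psum_loss alpha theta_star l theta - psum_loss alpha theta_star l x in
    [/\ 0 <= u * dp -> 0 <= df, u * dp <= 0 -> df <= 0 & u * dp < 0 -> df < 0] /\
    (0 < u * dp -> 0 < df).
Proof.
move=> u u0; have un0 : 0 < `|u| by rewrite normr_gt0.
have [e e0 eP] := psum_continuous_at alpha l x un0.
exists e => // theta the dp df; have dpu := eP theta the; rewrite -/dp in dpu.
have udf : u ^+ 2 * df = u * dp * (u * (2 * u + dp) / 2).
  by rewrite /df /psum_loss /dp /u; field.
have pos : 0 < u * (2 * u + dp) / 2.
  rewrite divr_gt0 //.
  have h : - (u * dp) <= u ^+ 2.
    apply: le_trans (ler_norm _) _; rewrite normrN normrM -(@real_normK _ u) ?num_real //.
    by rewrite expr2 ler_wpM2l.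
  have u2 : 0 < u ^+ 2 by rewrite -(@real_normK _ u) ?num_real // exprn_gt0.
  by move: h u2; rewrite expr2; lra.
have u2 : 0 < u ^+ 2 by rewrite -(@real_normK _ u) ?num_real // exprn_gt0.
rewrite -(pmulr_rge0 df u2) -(pmulr_rle0 df u2) -(pmulr_rlt0 df u2) -(pmulr_rgt0 df u2) udf.
by rewrite !(pmulr_lge0 _ pos, pmulr_lle0 _ pos, pmulr_llt0 _ pos, pmulr_lgt0 _ pos).
Qed.

(** Equal weights allow the coordinates of [x] and [theta] to be sorted independently;
    [interlacing_primitive] then makes all terms of one sign, with no closeness assumption. *)
Lemma uniform_simple_extremum (R : realType) (K : nat) (alpha : 'I_K -> R)
    (theta x : 'rV[R]_K) (b : bool) :
  let n := size (coord_values x) in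
  (forall j, alpha j = K%:R^-1) -> psum_variety alpha theta n x ->
  simple_blocks b x ->
  0 <= (-1) ^+ b * (psum alpha n.+1 theta - psum alpha n.+1 x).
Proof.
move=> n unif Vx simple.
pose s (v : 'rV[R]_K) := sort >=%R (codom (v 0)).
have ss v : size (s v) = K by rewrite size_sort size_codom card_ord.
have [|||j jK|k kn sk|p [ps pl pP]] := @interlacing_primitive R K n
  (nth 0 (s x)) (nth 0 (s theta)) (nth 0 (coord_values x)) b.
- by move=> i j ij jK; apply: nth_sort_ge; rewrite // size_codom card_ord.
- by move=> i j ij jK; apply: nth_sort_ge; rewrite // size_codom card_ord.
- by move=> i k; apply: coord_values_lt.
- have : nth 0 (s x) j \in coord_values x.
    by rewrite mem_coord_values -(mem_sort >=%R) mem_nth // ss.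
  move=> h; exists (index (nth 0 (s x) j) (coord_values x)); first by rewrite index_mem.
  by rewrite nth_index.
- set v := nth 0 (coord_values x) k.
  have cv : count_mem v (s x) = 1%N by rewrite (permP (permEl (perm_sort _ _))) simple.
  have vs : v \in s x by rewrite -has_pred1 has_count cv.
  exists (index v (s x)); split; first by rewrite -[X in (_ < X)%N](ss x) index_mem.
    by rewrite nth_index.
  move=> i iK iv; have isz : (i < size (s x))%N by rewrite ss.
  have sE := cat_take_drop i (s x); rewrite (drop_nth 0 isz) iv in sE.
  move: cv; rewrite -sE count_cat /= eqxx addnCA add1n => -[] /eqP.
  rewrite addn_eq0 => /andP[/eqP/count_memPn vt _].
  by rewrite index_cat (negPf vt) /= eqxx addn0 size_takel // ltnW.
have Vth : psum_variety alpha x n theta by move=> l ln; rewrite Vx.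
have := psum_variety_horner Vth ps; rewrite pl => /(congr1 ( *%R n.+1%:R)).
rewrite mulrA divff ?pnatr_eq0 // mul1r => <-.
have sumE (v : 'rV[R]_K) : \sum_(j < K) p.[v 0 j] = \sum_(j < K) p.[nth 0 (s v) j].
  have -> : \sum_(j < K) p.[v 0 j] = \sum_(t <- codom (v 0)) p.[t].
    by rewrite big_map big_enum.
  rewrite -(perm_big _ (permEl (perm_sort >=%R _))) (big_nth 0) /= -/(s v) ss.
  by rewrite big_mkord.
have -> : \sum_(j < K) alpha j * (p.[theta 0 j] - p.[x 0 j]) =
    K%:R^-1 * \sum_(j < K) (p.[nth 0 (s theta) j] - p.[nth 0 (s x) j]).
  rewrite sumrB -!sumE -sumrB mulr_sumr.
  by apply: eq_bigr => j _; rewrite unif.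
rewrite mulrCA mulr_ge0 // mulrCA mulr_ge0 ?invr_ge0 // mulr_sumr.
by apply: sumr_ge0 => j _; apply: pP.
Qed.

(** * Local type of a point read from its multiplicities *)

Lemma coord_values_nodes (R : realType) (K : nat) (x : 'rV[R]_K) :
  let w := fun i : 'I_(size (coord_values x)) => nth 0 (coord_values x) i in
  [/\ injective w, forall j, x 0 j \in codom w & forall i, exists j, x 0 j = w i].
Proof.
split=> [i k /eqP|j|i].
- by rewrite nth_uniq ?sort_uniq ?undup_uniq // => /eqP/ord_inj.
- have xj : x 0 j \in coord_values x by rewrite mem_coord_values codom_f.
  have h := xj; rewrite -index_mem in h.
  by apply/codomP; exists (Ordinal h); rewrite /= nth_index.
have : nth 0 (coord_values x) i \in coord_values x by apply: mem_nth.
by rewrite mem_coord_values => /codomP[j ->]; exists j.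
Qed.

(** By [nodal_deriv_sign], the values where the second order term has the wrong sign sit at the
    positions assumed simple. *)
Lemma simple_blocks_extremum (R : realType) (K : nat) (alpha : 'I_K -> R)
    (x : 'rV[R]_K) (b : bool) :
  let n := size (coord_values x) in
  (forall j, 0 < alpha j) -> simple_blocks b x ->
  exists2 e, 0 < e & forall theta : 'rV[R]_K,
    (forall j, `|theta 0 j - x 0 j| <= e) -> psum_variety alpha x n theta ->
    0 <= (-1) ^+ b * (psum alpha n.+1 theta - psum alpha n.+1 x).
Proof.
move=> n alpha0 simple; have [w_inj xw _] := coord_values_nodes x.
have sgn (i : 'I_n) := @nodal_deriv_sign R n (nth 0 (coord_values x)) i
  (fun i k => @coord_values_lt R K x i k).
apply: (psum_local_extremum alpha0 w_inj xw); first by rewrite signr_eq0.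
- move=> j; have /codomP[i xi] := xw j; rewrite xi => neg k xk.
  have ib : odd i (+) b.
    move: neg (sgn i); rewrite -(signr_odd _ i) ltNge.
    case: (odd i) (b) => [] [] //= /negP neg; rewrite ?expr0 ?expr1 => /ltW //.
  have := simple i (ltn_ord i) ib; rewrite count_codom => /mem_card1[k' k'P].
  have := k'P k; have := k'P j; rewrite !inE xi xk !eqxx.
  by move=> /esym/eqP -> /esym/eqP ->.
- move=> j; have /codomP[i ->] := xw j; have := sgn i.
  by apply: contraTneq => /= ->; rewrite mulr0 ltxx.
Qed.

Lemma nonsimple_blocks_direction (R : realType) (K : nat) (alpha : 'I_K -> R)
    (x : 'rV[R]_K) (b : bool) :
  let n := size (coord_values x) in
  (forall j, 0 < alpha j) -> ~ simple_blocks b x ->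
  forall e, 0 < e -> exists theta : 'rV[R]_K,
    [/\ forall j, `|theta 0 j - x 0 j| <= e, psum_variety alpha x n theta
      & (-1) ^+ b * (psum alpha n.+1 theta - psum alpha n.+1 x) < 0].
Proof.
move=> n alpha0 nsimple e e0; have [w_inj xw wx] := coord_values_nodes x.
have [i [ib ci]] : exists i : 'I_n, odd i (+) b /\
    (1 < count_mem (nth 0%R (coord_values x) i) (codom (x 0%R)))%N.
  apply/not_existsP => no; apply: nsimple => k kn kb.
  have := no (Ordinal kn) => /not_andP[//|/negP]; rewrite /= -leqNgt => le1.
  apply/eqP; rewrite eqn_leq le1 -has_count has_pred1 -mem_coord_values.
  exact: mem_nth.
move: ci; rewrite count_codom => /card_gt1P[a [a' [/eqP ai /eqP a'i aa']]].
have sgn := @nodal_deriv_sign R n (nth 0 (coord_values x)) i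
  (fun i k => @coord_values_lt R K x i k).
have a'a : a' != a by rewrite eq_sym.
have xa : x 0 a' = x 0 a by rewrite ai a'i.
have sq : 0 < - (-1) ^+ b * (\prod_(k < n) ('X - (nth 0 (coord_values x) k)%:P))^`().[x 0 a].
  rewrite ai; move: sgn; rewrite -(signr_odd _ i).
  by case: (odd i) (b) ib => [] [] //= _; rewrite ?expr0 ?expr1 ?opprK.
have [theta [the Vth lt]] := psum_saddle_direction alpha0 w_inj xw wx a'a xa sq e0.
by exists theta; split=> //; rewrite -oppr_gt0 -mulNr.
Qed.

(** Representatives of the [n] largest values solve the constraints, and a representative of the
    next value is shifted. *)
Lemma excess_values_direction (R : realType) (K n : nat) (alpha : 'I_K -> R)
    (x : 'rV[R]_K) (s : R) :
  (forall j, 0 < alpha j) -> (n < size (coord_values x))%N -> s != 0 ->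
  forall e, 0 < e -> exists theta : 'rV[R]_K,
    [/\ forall j, `|theta 0 j - x 0 j| <= e, psum_variety alpha x n theta
      & 0 < s * (psum alpha n.+1 theta - psum alpha n.+1 x)].
Proof.
move=> alpha0 nx s0; have [w_inj _ wx] := coord_values_nodes x.
have {wx}[r rP] := boolp.choice wx.
pose r' (i : 'I_n) := r (widen_ord (ltnW nx) i).
apply: (@psum_noncritical_direction _ _ _ _ _ r' (r (Ordinal nx))) => //.
  by move=> i k; rewrite /r' !rP => /w_inj/(congr1 val) /= /ord_inj.
move=> i; rewrite /r' !rP; apply: contra_neq (_ : i != n :> nat).
  by move=> /w_inj/(congr1 val).
by rewrite neq_ltn ltn_ord.
Qed.

(** * Classification of the critical points at a generic parameter *)

Unset Implicit Arguments.

Theorem proposition4p1 (R : realType) (K n : nat) (alpha : 'I_K -> R)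
  (hK : (1 <= K)%N) (hn : (1 <= n)%N)
  (halpha : forall j, 0 < alpha j) (hsum : \sum_(j < K) alpha j = 1) :
  generic (fun theta_star : 'rV[R]_K =>
    let V := psum_variety alpha theta_star in
    let p := psum alpha n.+1 in
    let p_star := p theta_star in
    let f := psum_loss alpha theta_star n.+1 in
    let crit := critical_point alpha theta_star n in
    [/\ (* (a) *)
        forall x, (V n `\` V n.+1) x ->
          (crit f x <-> crit p x) /\ (crit p x <-> size (coord_values x) = n),
        (* (b) *)
        forall x, (V n `\` V n.+1) x -> crit f x ->
          let m := multiplicities x in
          [/\ even_entries_one m ->
                (p_star < p x -> local_min_on (V n) f x) /\
                (p x < p_star -> local_max_on (V n) f x),
              odd_entries_one m ->
                (p x < p_star -> local_min_on (V n) f x) /\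
                (p_star < p x -> local_max_on (V n) f x)
            & ~ even_entries_one m -> ~ odd_entries_one m ->
                saddle_point alpha theta_star n f x /\
                saddle_point alpha theta_star n p x]
      & (* (c) *)
        (forall j, alpha j = K%:R^-1) ->
        forall x, (V n `\` V n.+1) x -> ~ local_min_on (V n) f x]).
Proof.
case: K hK alpha halpha hsum => // K _ alpha alpha0 _.
have [N N0 NP] := generic_distinct_coords alpha0.
exists N => // theta_star /NP {N N0 NP} rigid V p p_star f crit.
(* With fewer than [n] distinct values, [rigid] would equate all power sums and put [x] in
   [V n.+1]. *)
have Vn x : (V n `\` V n.+1) x ->
    [/\ V n x, p x - p_star != 0 & (n <= size (coord_values x))%N].
  move=> [Vx nVx]; split=> //.
    rewrite subr_eq0; apply/eqP => pE; apply: nVx => l /andP[l0].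
    rewrite leq_eqVlt => /predU1P[->//|ln]; apply: Vx; rewrite l0.
    by rewrite -ltnS.
  rewrite size_coord_values leqNgt; apply/negP => dn; apply: nVx => l _.
  by apply: rigid => k /andP[k0 kd]; apply: Vx; rewrite k0 (leq_trans kd).
have Vtrans x theta : V n x -> psum_variety alpha x n theta -> V n theta.
  by move=> Vx xth l ln; rewrite xth // Vx.
have Vback x theta : V n x -> V n theta -> psum_variety alpha x n theta.
  by move=> Vx Vth l ln; rewrite Vx // Vth.
have critfp x : (V n `\` V n.+1) x -> crit f x <-> crit p x.
  move=> /Vn[Vx u0 _]; rewrite /crit /critical_point /f grad_psum_loss.
  split=> -[_ h]; split=> //; last exact: memvZ.
  by rewrite -[grad _ _](scalerK u0) memvZ.
have critn x : (V n `\` V n.+1) x -> crit p x <-> size (coord_values x) = n.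
  move=> /Vn[Vx u0 nx]; rewrite /crit critical_point_distinct_coords //.
  rewrite -size_coord_values; split=> [[_ xn]|->] //.
  by apply/eqP; rewrite eqn_leq xn.
have fmono x : (V n `\` V n.+1) x -> exists2 e, 0 < e & forall theta : 'rV[R]_K.+1,
    (forall j, `|theta 0 j - x 0 j| <= e) ->
    let u := p x - p_star in let dp := p theta - p x in
    [/\ 0 <= u * dp -> f x <= f theta, u * dp <= 0 -> f theta <= f x,
        u * dp < 0 -> f theta < f x & 0 < u * dp -> f x < f theta].
  move=> /Vn[Vx u0 _]; have [e e0 eP] := psum_loss_monotone u0.
  exists e => // theta the u dp; have [[h1 h2 h3] h4] := eP theta the.
  split.
  - by move=> /h1; rewrite subr_ge0.
  - by move=> /h2; rewrite subr_le0.
  - by move=> /h3; rewrite subr_lt0.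
  - by move=> /h4; rewrite subr_gt0.
have not_min (h : 'rV[R]_K.+1 -> R) x : V n x ->
    (forall e, 0 < e -> exists theta : 'rV[R]_K.+1,
      [/\ forall j, `|theta 0 j - x 0 j| <= e, psum_variety alpha x n theta
        & h theta < h x]) -> ~ local_min_on (V n) h x.
  move=> Vx ex [_ /near_within_rVP[e e0 eP]]; have [theta [the xth lt]] := ex e e0.
  by have := eP theta (Vtrans _ _ Vx xth) the; rewrite leNgt lt.
have not_max (h : 'rV[R]_K.+1 -> R) x : V n x ->
    (forall e, 0 < e -> exists theta : 'rV[R]_K.+1,
      [/\ forall j, `|theta 0 j - x 0 j| <= e, psum_variety alpha x n theta
        & h x < h theta]) -> ~ local_max_on (V n) h x.
  move=> Vx ex [_ /near_within_rVP[e e0 eP]]; have [theta [the xth lt]] := ex e e0.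
  by have := eP theta (Vtrans _ _ Vx xth) the; rewrite leNgt lt.
(* Multiplying [s * (p theta - p x)] by [s * (p x - p_star)] gives, up to the factor [s ^+ 2], the
   product whose sign governs the loss in [fmono]. *)
have fdir x (s : R) : (V n `\` V n.+1) x -> s != 0 ->
    (forall e, 0 < e -> exists theta : 'rV[R]_K.+1,
      [/\ forall j, `|theta 0 j - x 0 j| <= e, psum_variety alpha x n theta
        & 0 < s * (p theta - p x)]) ->
    (s * (p x - p_star) < 0 -> ~ local_min_on (V n) f x) /\
    (0 < s * (p x - p_star) -> ~ local_max_on (V n) f x).
  move=> Vx s0 ex; have [Vnx u0 _] := Vn x Vx; have [d d0 dP] := fmono x Vx.
  have s2 : 0 < s ^+ 2 by rewrite -(@real_normK _ s) ?num_real // exprn_gt0 // normr_gt0.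
  have near e : 0 < e -> exists theta : 'rV[R]_K.+1,
      [/\ forall j, `|theta 0 j - x 0 j| <= e, forall j, `|theta 0 j - x 0 j| <= d,
        psum_variety alpha x n theta & 0 < s * (p theta - p x)].
    move=> e0; have [|theta [the xth lt]] := ex (Num.min d e).
      by rewrite lt_min d0.
    exists theta; split=> // j; apply: le_trans (the j) _.
      by rewrite ge_min lexx orbT.
    by rewrite ge_min lexx.
  split=> su; [apply: not_min => // | apply: not_max => //] => e /near[theta [the thd xth lt]];
    exists theta; split=> //; have [_ _ hlt hgt] := dP theta thd.
    by apply: hlt; rewrite -(pmulr_rlt0 _ s2) expr2 mulrACA nmulr_rlt0.
  by apply: hgt; rewrite -(pmulr_rgt0 _ s2) expr2 mulrACA pmulr_rgt0.
have nonsimple b x : (V n `\` V n.+1) x -> size (coord_values x) = n ->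
    ~ simple_blocks b x -> forall e, 0 < e -> exists theta : 'rV[R]_K.+1,
      [/\ forall j, `|theta 0 j - x 0 j| <= e, psum_variety alpha x n theta
        & 0 < - (-1) ^+ b * (p theta - p x)].
  move=> Vx xn nb e e0; have := nonsimple_blocks_direction alpha0 nb e0.
  rewrite xn => -[theta [the xth lt]]; exists theta; split=> //.
  by rewrite mulNr oppr_gt0.
have sgn0 b : - (-1) ^+ b != 0 :> R by rewrite oppr_eq0 signr_eq0.
have extr b x : (V n `\` V n.+1) x -> crit f x -> simple_blocks b x ->
    (0 < (-1) ^+ b * (p x - p_star) -> local_min_on (V n) f x) /\
    ((-1) ^+ b * (p x - p_star) < 0 -> local_max_on (V n) f x).
  move=> Vx /(critfp x Vx)/(critn x Vx) xn simple.
  have [Vnx u0 _] := Vn x Vx; have [d d0 dP] := fmono x Vx.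
  have := simple_blocks_extremum alpha0 simple; rewrite xn => -[e e0 eP].
  have sb : (-1) ^+ b * (-1) ^+ b = 1 :> R by rewrite -expr2 sqrr_sign.
  have uE theta : (p x - p_star) * (p theta - p x) =
      ((-1) ^+ b * (p x - p_star)) * ((-1) ^+ b * (p theta - p x)).
    by rewrite mulrACA sb mul1r.
  have near theta : V n theta ->
      (forall j, `|theta 0 j - x 0 j| <= Num.min d e) ->
      (forall j, `|theta 0 j - x 0 j| <= d) /\ 0 <= (-1) ^+ b * (p theta - p x).
    move=> Vth the; split=> [j|].
      by apply: le_trans (the j) _; rewrite ge_min lexx.
    apply: eP => [j|]; last exact: Vback.
    by apply: le_trans (the j) _; rewrite ge_min lexx orbT.
  have m0 : 0 < Num.min d e by rewrite lt_min d0.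
  split=> su; split=> //; apply/near_within_rVP; exists (Num.min d e) => // theta Vth;
    move=> /(near theta Vth)[/dP[hge hle _ _] ge0].
    by apply: hge; rewrite uE mulr_ge0 // ltW.
  by apply: hle; rewrite uE mulr_le0_ge0 // ltW.
split=> [x Vx|x Vx cx m|unif x Vx].
- by split; [apply: critfp | apply: critn].
- have xn : size (coord_values x) = n by apply/(critn x Vx)/(critfp x Vx).
  have [Vnx u0 _] := Vn x Vx; split.
  + move=> /even_entries_one_simple/(extr _ _ Vx cx); rewrite expr0 mul1r.
    by rewrite subr_gt0 subr_lt0.
  + move=> /odd_entries_one_simple/(extr _ _ Vx cx); rewrite expr1 mulN1r.
    by rewrite oppr_gt0 oppr_lt0 subr_gt0 subr_lt0.
  (* Failure of the first form lets p_(n+1) decrease near [x], failure of the second lets it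
     increase; together they exclude both kinds of extremum, for [p] and for [f]. *)
  move=> /even_entries_one_simple/(nonsimple _ _ Vx xn) dir0.
  move=> /odd_entries_one_simple/(nonsimple _ _ Vx xn) dir1.
  have [min0 max0] := fdir x _ Vx (sgn0 false) dir0.
  have [min1 max1] := fdir x _ Vx (sgn0 true) dir1.
  rewrite ?expr0 ?expr1 ?opprK ?mul1r ?mulN1r ?oppr_gt0 ?oppr_lt0 in min0 max0 min1 max1.
  split; split=> //.
  + by move: u0; rewrite neq_lt => /orP[/min1|/min0].
  + by move: u0; rewrite neq_lt => /orP[/max0|/max1].
  + exact/critfp.
  + apply: not_min => // e /dir0[theta [the xth]]; rewrite expr0 mulN1r oppr_gt0 subr_lt0 => lt.
    by exists theta.
  + apply: not_max => // e /dir1[theta [the xth]]; rewrite expr1 opprK mul1r subr_gt0 => lt.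
    by exists theta.
have [Vnx u0 nx] := Vn x Vx; set u := p x - p_star in u0.
(* With more than [n] values, [p] moves to first order towards [p_star], which lowers the loss. *)
move: nx; rewrite leq_eqVlt => /predU1P[xn|xn]; last first.
  have su : - u != 0 by rewrite oppr_eq0.
  have [h _] := fdir x (- u) Vx su (excess_values_direction alpha0 xn su).
  by apply: h; rewrite mulNr oppr_lt0 -expr2 -(@real_normK _ u) ?num_real // exprn_gt0 // normr_gt0.
pose b := u < 0.
have bu : 0 < (-1) ^+ b * u.
  rewrite /b; move: u0; rewrite neq_lt => /orP[lt|gt].
    by rewrite lt expr1 mulN1r oppr_gt0.
  have -> : (u < 0) = false by apply/negbTE; rewrite -leNgt ltW.
  by rewrite expr0 mul1r.
(* A multiple value at a position selected by [b] allows [p] to approach [p_star]. Otherwise [x] is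
   extremal for [p] against [theta_star] itself, with a sign contradicting [bu]. *)
have [simple|nsimple] := pselect (simple_blocks b x); last first.
  have [h _] := fdir x _ Vx (sgn0 b) (nonsimple b x Vx (esym xn) nsimple).
  by apply: h; rewrite mulNr oppr_lt0.
have := uniform_simple_extremum (b := b) (x := x) (theta := theta_star) unif.
rewrite -xn => /(_ Vnx simple); rewrite -/p -opprB mulrN oppr_ge0 -/p_star -/u.
by rewrite leNgt bu.
Qed.
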